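(* Let $0<\sigma\le1<\mu$, let $J$ be a finite set, $\eta_1,\eta_{2,i}\ge0$ and $\rho_i\in[0,1)$ for $i\in J$, $\alpha\in\mathbb R$, and let $\Xi\in C^{\sigma,\mu,\eta}_{2,\alpha,\rho}((0,T],V)$ (defined in the context). Let $\beta\ge0$ be such that $\beta+\rho_i<1$ for every $i\in J$. 1. Then, for every $0<s<t\le T$, the limit over partitions $\mathcal P$ of $[s,t]$ $$(\mathcal I\Xi)_{t,s}:=\lim_{|\mathcal P|\to0}\sum_{[u,v]\in\mathcal P}S_{t-v}\Xi_{v,u}\in V_{\alpha,t}$$ exists and satisfies $(\mathcal I\Xi)_{t,s}=(\mathcal I\Xi)_{t,u}+S_{t-u}(\mathcal I\Xi)_{u,s}$ for $s<u<t$, and $$\big|(\mathcal I\Xi)_{t,s}-\Xi_{t,s}\big|_{\alpha+\beta,t}\lesssim\llbracket\tilde\Xi\rrbracket_{\mu;\eta_2;T}\sum_is^{-\eta_{2,i}}|t-s|^{\mu-\rho_i-\beta}.$$ 2. Assume in addition that $\sigma>\eta_1$ and $\mu>\eta_{2,i}+\rho_i$ for each $i$. Then, for every $t\in(0,T]$, the limit $(\mathcal I\Xi)_{t,0}:=\lim_{s\downarrow0}(\mathcal I\Xi)_{t,s}\in V_{\alpha+\beta,t}$ exists and $$\big|(\mathcal I\Xi)_{t,0}\big|_{\alpha+\beta,t}\lesssim\llbracket\tilde\Xi\rrbracket_{\sigma;\eta_1;T}\,t^{\sigma-\beta-\eta_1}+\sum_i\llbracket\tilde\Xi\rrbracket_{\mu;\eta_2;T}\,t^{\mu-\rho_i-\beta-\eta_{2,i}}.$$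 The implicit constants in both estimates are independent of $t,s\in(0,T]$ and of $\Xi\in C^{\sigma,\mu,\eta}_{2,\alpha,\rho}((0,T],V)$.
   Context: $(V_{\alpha,t},|\cdot|_{\alpha,t})$, $\alpha\in\mathbb R$, $t\in[0,T]$, are fixed Banach spaces such that $V_{\beta,s}\subset V_{\alpha,t}$ whenever $s\le t$ and $\beta\ge\alpha$, with embedding norm at most $1$. $(S_t)$ is a semigroup (of linear maps) acting on these spaces and satisfying $$|S_tu|_{\alpha+\beta,\tau}\lesssim t^{-\beta}|u|_{\alpha,\tau},\qquad|S_tu-u|_{\alpha-\gamma,\tau}\lesssim t^\gamma|u|_{\alpha,\tau},$$ uniformly in $\gamma\in[0,1]$ and $u\in V_{\alpha,\tau}$, and uniformly over times $t,\tau$ and over $\beta\ge0$, $\alpha$ in compact sets. For increments $\Xi_{t,s}\in V_{\alpha,t}$, $t\ge s>0$, write $(\hat\delta\Xi)_{t,u,s}=\Xi_{t,s}-\Xi_{t,u}-S_{t-u}\Xi_{u,s}$. For $\sigma,\mu>0$, a finite set $J$, $\eta=(\eta_1,(\eta_{2,j})_{j\in J})$, $\rho=(\rho_j)_{j\in J}$ with $\eta_1,\eta_{2,j},\rho_j\ge0$, and $\alpha\in\mathbb R$, the space $C^{\sigma,\mu,\eta}_{2,\alpha,\rho}((0,T],V)$ consists of increments $\{\Xi_{t,s}\}_{0<s<t\le T}$ with $$\Xi_{t,s}=S_{t-s}\tilde\Xi_{t,s},\qquad(\hat\delta\Xi)_{t,u,s}=\sum_{i\in J}S_{t-u}\tilde\Xi^i_{t,u,s}$$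 for some $\tilde\Xi_{t,s}\in V_{\alpha,t}$ and $\tilde\Xi^i_{t,u,s}\in V_{\alpha-\rho_i,t}$ satisfying $$\llbracket\tilde\Xi\rrbracket_{\sigma;\eta_1;T}:=\sup_{0<s<t\le T}\frac{|\tilde\Xi_{t,s}|_{\alpha,t}}{s^{-\eta_1}|s-t|^\sigma}<\infty,\qquad\llbracket\tilde\Xi\rrbracket_{\mu;\eta_2;T}:=\sum_{i\in J}\sup_{0<s<u<t\le T}\frac{|\tilde\Xi^i_{t,u,s}|_{\alpha-\rho_i,t}}{|t-s|^\mu s^{-\eta_{2,i}}}<\infty.$$ A partition $\mathcal P$ of $[s,t]$ is a finite collection of closed intervals with union $[s,t]$, any two of which intersect in at most a point; $|\mathcal P|$ is the length of its largest interval. *)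

(* Defs.v *)
From HB Require Import structures.
From mathcomp Require Import all_boot all_order all_algebra.
From mathcomp Require Import all_classical all_reals all_analysis.
Import Order.TTheory GRing.Theory Num.Theory.
Import numFieldNormedType.Exports.

Set Implicit Arguments.
Unset Strict Implicit.
Unset Printing Implicit Defensive.

Local Open Scope classical_set_scope.
Local Open Scope ring_scope.

(* The Banach spaces [V a t] are all realised, through the injections [inj],
   inside one vector space [E], on which the semigroup [S] acts; inclusions
   between the spaces and identities between elements of different spaces are
   read in [E].  Only times in [0, T] are constrained. *)

Section Scale.
Context {R : realType} {E : lmodType R}.
Context {V : R -> R -> completeNormedModType R}.
Variables (T : R) (inj : forall a t : R, {linear V a t -> E}).

(* [x] belongs to [V a t] and its norm there is at most [M] *)
Definition norm_le (a t : R) (x : E) (M : \bar R) : Prop :=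
  exists2 y : V a t, inj a t y = x & ((`|y|)%:E <= M)%E.

Definition nested_scale : Prop :=
  (forall a t : R, 0 <= t -> t <= T -> injective (inj a t)) /\
  (forall a b s t : R, 0 <= s -> s <= t -> t <= T -> a <= b ->
    forall u : V b s, norm_le a t (inj b s u) (`|u|)%:E).

Variable S : R -> {linear E -> E}.

Definition semigroup : Prop :=
  (forall x : E, S 0 x = x) /\
  (forall (s t : R) (x : E), 0 <= s -> 0 <= t -> S (s + t) x = S s (S t x)).

Definition smoothing : Prop :=
  forall A B : set R, compact A -> compact B ->
  exists C : R, forall a b t tau : R, A a -> B b -> 0 <= b ->
    0 < t -> t <= T -> 0 <= tau -> tau <= T ->
    forall u : V a tau,
      norm_le (a + b) tau (S t (inj a tau u)) (C * t `^ (- b) * `|u|)%:E.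

Definition time_regularity : Prop :=
  forall A : set R, compact A ->
  exists C : R, forall a g t tau : R, A a -> 0 <= g -> g <= 1 ->
    0 < t -> t <= T -> 0 <= tau -> tau <= T ->
    forall u : V a tau,
      norm_le (a - g) tau (S t (inj a tau u) - inj a tau u)
        (C * t `^ g * `|u|)%:E.

End Scale.

(* The partition s = x_0 < x_1 < ... < x_n = t is encoded, as in
   [itv_partition s t], by the list [:: x_1; ...; x_n]. *)
Section Partitions.
Context {R : realType}.

Definition subintervals (s : R) (P : seq R) : seq (R * R) := zip (s :: P) P.

Definition mesh (s : R) (P : seq R) : R :=
  \big[Num.max/0]_(uv <- subintervals s P) (uv.2 - uv.1).

(* the filter "partitions P of [s, t] with |P| -> 0" *)
Definition fine_partitions (s t : R) : set_system (seq R) :=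
  [set A | exists2 d : R, 0 < d &
     forall P : seq R, itv_partition s t P -> mesh s P < d -> A P].

End Partitions.

Section Increments.
Context {R : realType} {E : lmodType R}.
Context {V : R -> R -> completeNormedModType R}.
Variables (T : R) (inj : forall a t : R, {linear V a t -> E}).
Variable S : R -> {linear E -> E}.

(* Increments take the later time first: [Xi t s] is $\Xi_{t,s}$.  They are
   total functions, of which only the values at 0 < s < t <= T matter. *)

Definition hdelta (alpha : R) (Xi : forall t : R, R -> V alpha t)
    (t u s : R) : E :=
  inj alpha t (Xi t s) - inj alpha t (Xi t u)
  - S (t - u) (inj alpha u (Xi u s)).

Definition seminorm2 (alpha sigma eta1 : R)
    (Xit : forall t : R, R -> V alpha t) : \bar R :=
  ereal_sup [set x | exists s t : R, [/\ 0 < s, s < t, t <= T &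
    x = (`|Xit t s| / (s `^ (- eta1) * `|s - t| `^ sigma))%:E]].

Definition seminorm3 (J : finType) (alpha mu : R) (rho eta2 : J -> R)
    (Xid : forall (i : J) (t : R), R -> R -> V (alpha - rho i) t) : \bar R :=
  let term (i : J) := ereal_sup [set x | exists s u t : R,
    [/\ 0 < s, s < u, u < t, t <= T &
     x = (`|Xid i t u s| / (`|t - s| `^ mu * s `^ (- eta2 i)))%:E]] in
  (\sum_(i : J) term i)%E.

(* [Xi] lies in $C^{\sigma,\mu,\eta}_{2,\alpha,\rho}((0,T],V)$, as witnessed by
   $\tilde\Xi$ = [Xit] and $(\tilde\Xi^i)_i$ = [Xid]. *)
Definition in_C2 (J : finType) (alpha sigma mu eta1 : R) (rho eta2 : J -> R)
    (Xi Xit : forall t : R, R -> V alpha t)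
    (Xid : forall (i : J) (t : R), R -> R -> V (alpha - rho i) t) : Prop :=
  [/\ forall s t : R, 0 < s -> s < t -> t <= T ->
        inj alpha t (Xi t s) = S (t - s) (inj alpha t (Xit t s)),
      forall s u t : R, 0 < s -> s < u -> u < t -> t <= T ->
        hdelta Xi t u s =
          \sum_(i : J) S (t - u) (inj (alpha - rho i) t (Xid i t u s)),
      (seminorm2 sigma eta1 Xit < +oo)%E &
      (seminorm3 mu eta2 Xid < +oo)%E].

Definition sewing_sum (alpha : R) (Xi : forall t : R, R -> V alpha t)
    (t s : R) (P : seq R) : E :=
  \sum_(uv <- subintervals s P) S (t - uv.2) (inj alpha uv.2 (Xi uv.2 uv.1)).

(* The sums lie in [V alpha t] and converge to [x] there. *)
Definition sewing_limit (alpha : R) (Xi : forall t : R, R -> V alpha t)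
    (t s : R) (x : V alpha t) : Prop :=
  exists2 sm : seq R -> V alpha t,
    forall P : seq R, itv_partition s t P ->
      inj alpha t (sm P) = sewing_sum Xi t s P &
    sm P @[P --> fine_partitions s t] --> x.

End Increments.

(* Main.v *)
Require Import Defs.
From HB Require Import structures.
From mathcomp Require Import all_boot all_order all_algebra.
From mathcomp Require Import all_classical all_reals all_analysis.
From mathcomp Require Import ring lra.
Import Order.TTheory GRing.Theory Num.Theory.
Import numFieldNormedType.Exports.

Set Implicit Arguments.
Unset Strict Implicit.
Unset Printing Implicit Defensive.

Local Open Scope classical_set_scope.
Local Open Scope ring_scope.

(** Fix [t] and read everything in the Banach space [V (alpha + beta) t], where
    [A u v = S (t - v) (Xi v u)] is a germ whose sums over partitions of [[s, t]]
    are the sums to be controlled. The algebraic assumption on [Xi] turns into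
    [A a b - A a m - A m b = \sum_i S (t - m) (Xid i b m a)], so smoothing bounds
    this defect by [phi m * (b - a) `^ mu], where [phi m] is a combination of the
    powers [(t - m) `^ (- (beta + rho i))]. The exponents are less than 1, but
    [phi] still blows up when [m] tends to [t], and arbitrary partitions may have
    points very close to [t]: the sewing lemma does not apply as it stands.

    The way out is that the defect is an alternating sum of defects at other
    points. When [m] lies beyond the midpoint [c] of [[a, b]],
    [defect (a, m, b) = defect (a, c, b) + defect (c, m, b) - defect (a, c, m)];
    at [c] the weight is comparable with [phi a], and [defect (c, m, b)] lives on
    an interval half as long. Iterating, the losses form a geometric series
    because [mu > 1], and the weight [phi m] is replaced with [phi a]
    ([delta_desingularised]). Since [phi] is integrable, [phi a * (b - a)] is at
    most the increment [G b - G a] of a bounded function, so that the defect is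
    bounded by [(b - a) `^ (mu - 1) * (G b - G a)], a power of the mesh times an
    additive quantity. From there on the usual sewing argument works for all
    partitions: [germ_sum_maximal] compares a sum with the value of the germ,
    [germ_sum_refine] a sum with that of a refinement, and completeness gives the
    limit ([singular_sewing], [sewing_in_scale]). Chasles' relation is then read
    off from concatenated partitions.

    For the limit at 0, [I t s' - I t s = S (t - s) (I s s')] when [s' < s]. On a
    window [s / 2 <= s' < s] the blow-up in [s'] is comparable with the same power
    of [s], and the estimate without gain of regularity bounds [I s s'] by a sum
    of positive powers of [s] ([sewn_window]). Chaining windows of geometrically
    decreasing size ([dyadic_limit]) gives the Cauchy property at 0 and the bound;
    the semigroup always acts for a time at least [t / 2], which costs the factor
    [t `^ (- beta)] once. *)

(** * Inequalities for real powers and sums *)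

Lemma powR_half (R : realType) (x p : R) :
  0 <= x -> (x / 2) `^ p = 2 `^ (- p) * x `^ p.
Proof.
move=> x0; rewrite powRM ?invr_ge0// mulrC; congr (_ * _).
by rewrite -powR_inv1 // -powRrM mulN1r.
Qed.

Lemma two_powR_lt1 (R : realType) (p : R) : p < 0 -> 2 `^ p < 1 :> R.
Proof.
move=> p0; rewrite -[p]opprK powRN invf_lt1 ?powR_gt0//.
rewrite [ltLHS](_ : _ = 1 `^ (- p)); last by rewrite powR1.
by apply: gt0_ltr_powR; rewrite ?nnegrE; lra.
Qed.

Lemma small_powR (R : realType) (p c e : R) : 0 < p -> 0 <= c -> 0 < e ->
  exists2 d, 0 < d & c * d `^ p < e.
Proof.
move=> p0 c0 e0; exists ((e / (c + 1)) `^ p^-1).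
  by rewrite powR_gt0// divr_gt0// ltr_wpDl.
rewrite -powRrM mulVf ?gt_eqF// powRr1; last by apply: divr_ge0; lra.
by rewrite mulrA ltr_pdivrMr ?ltr_wpDl// mulrC ltr_pM2l// ltrDl ltr01.
Qed.

Lemma powR_antitone (R : realType) (x y g : R) :
  0 < x -> x <= y -> 0 <= g -> y `^ (- g) <= x `^ (- g).
Proof.
move=> x0 xy g0; rewrite !powRN lef_pV2 ?posrE ?powR_gt0//; last first.
  exact: lt_le_trans xy.
by apply: ge0_ler_powR; rewrite ?nnegrE; lra.
Qed.

(** A discrete integral comparison without integrals: for [y <= x] the left side
    is [(1 - g)] times the area of a rectangle below the graph of [z `^ (- g)] on
    [[y, x]]. It is the weighted arithmetic-geometric inequality
    [y `^ (1 - g) * x `^ g <= (1 - g) * y + g * x] divided by [x `^ g]. *)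
Lemma powR_concave (R : realType) (x y g : R) :
    0 < x -> 0 <= y -> 0 <= g -> g < 1 ->
  (1 - g) * (x `^ (- g) * (x - y)) <= x `^ (1 - g) - y `^ (1 - g).
Proof.
move=> x0 y0; rewrite le_eqVlt => /predU1P[<- _|g0 g1].
  by rewrite oppr0 powRr0 addr0 !mul1r !powRr1 // ltW.
have g1' : 0 < 1 - g by rewrite subr_gt0.
have := @conjugate_powR R (y `^ (1 - g)) (x `^ g) (1 - g)^-1 g^-1
  (powR_ge0 _ _) (powR_ge0 _ _).
rewrite !invr_gt0 !invrK subrK => /(_ g1' g0 erefl).
have x0w := ltW x0.
rewrite -!powRrM !divff ?gt_eqF// !powRr1// => young.
have -> : x `^ (1 - g) = x `^ (- g) * x.
  by rewrite powRD ?(gt_eqF x0) ?implybT// powRr1 ?ltW// mulrC.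
have y_le : y `^ (1 - g) <= x `^ (- g) * (y * (1 - g) + x * g).
  rewrite -ler_pdivrMl ?powR_gt0//; apply: le_trans young.
  by rewrite mulrC powRN invrK.
by move: y_le; rewrite !mulrDr mulrN; lra.
Qed.

Lemma powR_window (R : realType) (s s' e p : R) : 0 < s' -> s <= 2 * s' -> s' < s ->
  0 <= e -> 0 <= p -> s' `^ (- e) * (s - s') `^ p <= 2 `^ e * s `^ (p - e).
Proof.
move=> s'0 s2 s's e0 p0; have s0 : 0 < s by lra.
rewrite [s `^ (p - e)]powRD ?(gt_eqF s0) ?implybT//.
rewrite [s `^ p * _]mulrC mulrA.
apply: ler_pM; [exact: powR_ge0|exact: powR_ge0| |].
  apply: (@le_trans _ _ ((s / 2) `^ (- e))).
    by apply: powR_antitone => //; lra.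
  by rewrite powR_half ?opprK// ltW.
by apply: ge0_ler_powR; rewrite ?nnegrE; lra.
Qed.

Lemma ler_sum_product (R : realDomainType) (J : finType) (k0 x0 : R)
    (k x : J -> R) :
    0 <= k0 -> 0 <= x0 -> (forall i, 0 <= k i) -> (forall i, 0 <= x i) ->
  k0 * x0 + \sum_(i : J) k i * x i
    <= (k0 + \sum_(i : J) k i) * (x0 + \sum_(i : J) x i).
Proof.
move=> k0_ge0 x0_ge0 k_ge0 x_ge0.
have sum_ge0 : 0 <= \sum_(i : J) k i by exact: sumr_ge0.
rewrite mulrDr; apply: lerD; first by rewrite ler_wpM2r// lerDl.
rewrite mulr_sumr; apply: ler_sum => i _; rewrite ler_wpM2r//.
by rewrite (bigD1 i)//= addrCA lerDl addr_ge0// sumr_ge0.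
Qed.

(** * Partitions and their mesh *)
Lemma path_lt_last (R : realType) (a : R) P : path <%R a P -> a <= last a P.
Proof. by move=> aP; apply: (itv_partition_le (s := P)). Qed.

Section Mesh.
Context {R : realType}.
Implicit Types (a b d s t : R) (P Q : seq R).

Lemma mesh_nil s : mesh s [::] = 0.
Proof. by rewrite /mesh big_nil. Qed.

Lemma mesh_cons s x P : mesh s (x :: P) = Num.max (x - s) (mesh x P).
Proof. by rewrite /mesh /subintervals /= big_cons. Qed.

Lemma mesh_cat s P Q :
  mesh s (P ++ Q) = Num.max (mesh s P) (mesh (last s P) Q).
Proof.
elim: P s => [|x P IH] s /=; last by rewrite !mesh_cons IH maxA.
rewrite mesh_nil; apply/esym/max_idPr.
by case: Q => [|x Q]; rewrite ?mesh_nil// /mesh; exact: bigmax_ge_id.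
Qed.

Lemma exists_fine_partition a b d : a < b -> 0 < d ->
  exists2 P, itv_partition a b P & mesh a P < d.
Proof.
move=> ab d0.
have [n] : exists n : nat, b - a < 2 ^+ n * d.
  exists (Num.bound ((b - a) / d)).
  rewrite -ltr_pdivrMr//; apply: lt_le_trans (archi_boundP _) _.
    by apply: divr_ge0; lra.
  by rewrite -natrX ler_nat ltnW// ltn_expl.
elim: n a b ab => [|n IH] a b ab.
  rewrite expr0 mul1r => bad; exists [:: b]; first exact: itv_partition1.
  by rewrite mesh_cons mesh_nil gt_max bad.
rewrite exprS => ban; pose c := (a + b) / 2.
have [||P Pac Pd] := IH a c; [by rewrite /c; lra..|].
have [||Q Qcb Qd] := IH c b; [by rewrite /c; lra..|].
exists (P ++ Q); first exact: itv_partition_cat Pac Qcb.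
by rewrite mesh_cat gt_max Pd; case: Pac => _ /eqP ->.
Qed.

#[export] Instance fine_partitions_filter s t : Filter (fine_partitions s t).
Proof.
split.
- by exists 1.
- move=> A B [d1 d10 hA] [d2 d20 hB].
  exists (Num.min d1 d2); first by rewrite lt_min d10.
  by move=> P Pst; rewrite lt_min => /andP[/hA{}hA /hB{}hB]; split; auto.
- move=> A B AB [d d0 hA]; exists d => // P Pst Pd; apply: AB; exact: hA.
Qed.

Lemma fine_partitions_proper s t : s < t -> ProperFilter (fine_partitions s t).
Proof.
move=> st; split; last exact: fine_partitions_filter.
by case=> d d0 /(_ _ _ _) h; have [P /h] := exists_fine_partition st d0.
Qed.

Lemma path_lt_last_max a b Q :
  path <%R a Q -> b \in Q -> {in Q, forall x, x <= b} -> last a Q = b.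
Proof.
move=> aQ bQ; case/splitPr: Q / bQ aQ => Q1 Q2.
rewrite cat_path last_cat /= => /and3P[_ _ bQ2] ub.
apply/eqP; rewrite eq_le path_lt_last// andbT ub// mem_cat.
by rewrite mem_last orbT.
Qed.

Lemma common_refinement a b P Q : a < b ->
    itv_partition a b P -> itv_partition a b Q ->
  exists Z, [/\ itv_partition a b Z, {subset P <= Z} & {subset Q <= Z}].
Proof.
move=> ab [aP /eqP Pb] [aQ /eqP Qb].
have le_b Z : path <%R a Z -> last a Z = b -> {in Z, forall x, x <= b}.
  move=> aZ <- x xZ; case/splitPr: Z / xZ aZ => Z1 Z2.
  by rewrite cat_path last_cat /= => /and3P[_ _]; exact: path_lt_last.
have bP : b \in P.
  by case: P Pb {aP} => [/= ba|x P <-]; [lra|rewrite /= mem_last].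
pose Z := sort <=%R (undup (P ++ Q)).
have memZ x : (x \in Z) = (x \in P) || (x \in Q).
  by rewrite mem_sort mem_undup mem_cat.
have aZ : path <%R a Z.
  rewrite (path_sortedE lt_trans) sort_lt_sorted undup_uniq andbT.
  apply/allP => x; rewrite memZ.
  by case/orP; [move: aP|move: aQ] => /(order_path_min lt_trans)/allP; exact.
exists Z; split=> [|x xP|x xQ]; rewrite ?memZ ?xP ?xQ ?orbT//.
split=> //; apply/eqP; apply: path_lt_last_max => //; first by rewrite memZ bP.
by move=> x; rewrite memZ => /orP[]; apply: le_b.
Qed.

End Mesh.

(** * Sewing of germs with a singularity at the right end *)
Section GermSum.
Context {R : realType} {W : zmodType}.
Implicit Types (A : R -> R -> W) (a s : R) (P Q : seq R).

Definition germ_sum A s P : W := \sum_(uv <- subintervals s P) A uv.1 uv.2.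

Lemma germ_sum_nil A s : germ_sum A s [::] = 0.
Proof. by rewrite /germ_sum big_nil. Qed.

Lemma germ_sum_cons A s x P : germ_sum A s (x :: P) = A s x + germ_sum A x P.
Proof. by rewrite /germ_sum /subintervals /= big_cons. Qed.

Lemma germ_sum_cat A s P Q :
  germ_sum A s (P ++ Q) = germ_sum A s P + germ_sum A (last s P) Q.
Proof.
elim: P s => [|x P IH] s /=; first by rewrite germ_sum_nil add0r.
by rewrite !germ_sum_cons IH addrA.
Qed.

End GermSum.

(** Splitting an interval into two halves multiplies the gauge
    [(b - a) `^ (mu - 1) * (G b - G a)] by [halving_ratio] at most; the two other
    constants are sums of geometric series with this ratio, and are used through
    the fixed point equations [delta_cst_eq] and [sewing_cst_eq]. *)
Section Constants.
Context {R : realType}.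
Variable mu : R.

Definition halving_ratio : R := 2 `^ (1 - mu).
Definition delta_cst : R := 4 / (1 - halving_ratio).
Definition sewing_cst : R := 2 * delta_cst / (1 - halving_ratio).

Lemma halving_ratio_gt0 : 0 < halving_ratio. Proof. exact: powR_gt0. Qed.

Hypothesis mu_gt1 : 1 < mu.

Lemma halving_ratio_lt1 : halving_ratio < 1.
Proof. by apply: two_powR_lt1; rewrite subr_lt0. Qed.

Lemma delta_cst_ge0 : 0 <= delta_cst.
Proof. by apply: divr_ge0; rewrite // subr_ge0 ltW// halving_ratio_lt1. Qed.

Lemma sewing_cst_ge0 : 0 <= sewing_cst.
Proof.
apply: divr_ge0; last by rewrite subr_ge0 ltW// halving_ratio_lt1.
by rewrite mulr_ge0// delta_cst_ge0.
Qed.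

Lemma delta_cst_eq : delta_cst = 4 + halving_ratio * delta_cst.
Proof.
by rewrite /delta_cst; field; rewrite subr_eq0 gt_eqF// halving_ratio_lt1.
Qed.

Lemma sewing_cst_eq : sewing_cst = 2 * delta_cst + halving_ratio * sewing_cst.
Proof.
by rewrite /sewing_cst; field; rewrite subr_eq0 gt_eqF// halving_ratio_lt1.
Qed.

End Constants.

(** The function [phi] is the weight of the defect of [A]. It may be unbounded
    near [t]; [phi_double] says that it at most doubles as long as the distance to
    [t] is not more than halved, and [phi_G] is the form in which its integrability is used. *)
Section Germ.
Context {R : realType} {W : completeNormedModType R}.
Variables (A : R -> R -> W) (s t mu : R) (phi G : R -> R).
Hypothesis mu_gt1 : 1 < mu.
Hypothesis A_diag : forall a, A a a = 0.
Hypothesis phi_ge0 : forall a, s <= a -> a < t -> 0 <= phi a.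
Hypothesis phi_double : forall a m, s <= a -> a <= m -> m < t ->
  2 * m <= a + t -> phi m <= 2 * phi a.
Hypothesis phi_G : forall a b, s <= a -> a < b -> b <= t ->
  phi a * (b - a) <= G b - G a.
Hypothesis A_delta : forall a m b, s <= a -> a < m -> m < b -> b <= t ->
  `|A a b - A a m - A m b| <= phi m * (b - a) `^ mu.

Local Notation theta := (halving_ratio mu).
Local Notation K := (delta_cst mu).
Local Notation M := (sewing_cst mu).
Definition gauge a b := (b - a) `^ (mu - 1) * (G b - G a).

Let theta_gt0 := halving_ratio_gt0 mu.
Let K_ge0 := delta_cst_ge0 mu_gt1.
Let K_eq := delta_cst_eq mu_gt1.

(** The weight [phi m], infinite in the limit where [m] tends to [t], is replaced
    with [phi a]. The induction is on the number of bisections after which [m] is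
    no longer beyond the midpoint: each one introduces two defects at the
    midpoint, whose weight is at most [2 * phi a], and passes to the right half,
    where the product of the weight and the power is multiplied by
    [halving_ratio]. *)
Lemma delta_desingularised a m b : s <= a -> a < m -> m < b -> b <= t ->
  `|A a b - A a m - A m b| <= K * (phi a * (b - a) `^ mu).
Proof.
move: mu_gt1 => mu1 sa am mb bt.
have [n] : exists n : nat, b - a < 2 ^+ n * (b - m).
  have bm0 : 0 < b - m by rewrite subr_gt0.
  exists (Num.bound ((b - a) / (b - m))).
  rewrite -ltr_pdivrMr//; apply: lt_le_trans (archi_boundP _) _.
    by apply: divr_ge0; lra.
  by rewrite -natrX ler_nat ltnW// ltn_expl.
elim: n a sa am => [|n IH] a sa am; first by rewrite expr0 mul1r; lra.
move=> ban.
have at_ : a < t by lra.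
have pa := phi_ge0 sa at_.
have pw : 0 <= (b - a) `^ mu by apply: powR_ge0.
have near_half x y : a < x -> 2 * x <= a + b -> x < y -> y <= b ->
    `|A a y - A a x - A x y| <= 2 * (phi a * (b - a) `^ mu).
  move=> ax x2 xy yb; apply: le_trans (A_delta sa ax xy _) _; first by lra.
  rewrite mulrA; apply: ler_pM; [|exact: powR_ge0| |].
  - by apply: phi_ge0; lra.
  - by apply: phi_double; lra.
  - by apply: ge0_ler_powR; rewrite ?nnegrE; lra.
have [mc|cm] := leP (2 * m) (a + b).
  apply: le_trans (near_half _ _ am mc mb (lexx b)) _.
  rewrite ler_wpM2r ?mulr_ge0// K_eq.
  have : 0 <= theta * K by rewrite mulr_ge0// ltW.
  lra.
pose c := (a + b) / 2.
have ac : a < c by rewrite /c; lra.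
have c2 : 2 * c <= a + b by rewrite /c; lra.
have cm' : c < m by rewrite /c; lra.
have cb : c < b by rewrite /c; lra.
have -> : A a b - A a m - A m b = (A a b - A a c - A c b)
    + (A c b - A c m - A m b) - (A a m - A a c - A c m).
  rewrite !addrA subrK opprB addrA [X in X + A c m]addrAC subrK opprB addrA.
  by rewrite [X in X + A a c]addrAC subrK addrAC.
apply: le_trans (ler_normB _ _) _.
apply: le_trans (lerD (ler_normD _ _) (lexx _)) _.
have h1 := near_half _ _ ac c2 cb (lexx b).
have h2 := near_half _ _ ac c2 cm' (ltW mb).
have h3 : `|A c b - A c m - A m b| <= K * (theta * (phi a * (b - a) `^ mu)).
  apply: le_trans (IH c _ cm' _) _; first by lra.
    by move: ban; rewrite exprS /c; lra.
  rewrite ler_wpM2l//.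
  have -> : b - c = (b - a) / 2 by rewrite /c; lra.
  rewrite powR_half ?subr_ge0; last lra.
  rewrite !mulrA ler_wpM2r//.
  have -> : theta = 2 * 2 `^ (- mu).
    by rewrite /halving_ratio powRD ?pnatr_eq0 ?implybT// powRr1.
  rewrite [leRHS]mulrC mulrA [_ * 2]mulrC ler_wpM2r ?powR_ge0//.
  by apply: phi_double; rewrite ?/c; lra.
rewrite [in leRHS]K_eq.
set z := phi a * _ in h1 h2 h3 *.
have -> : (4 + theta * K) * z = 2 * z + K * (theta * z) + 2 * z by ring.
by rewrite !lerD.
Qed.

Let G_mono a b : s <= a -> a <= b -> b <= t -> 0 <= G b - G a.
Proof.
move=> sa; rewrite le_eqVlt => /predU1P[->|ab] bt; first by rewrite subrr.
apply: le_trans (phi_G sa ab bt).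
by rewrite mulr_ge0 ?subr_ge0 ?(ltW ab)// phi_ge0// (lt_le_trans ab).
Qed.

Lemma gauge_ge0 a b : s <= a -> a <= b -> b <= t -> 0 <= gauge a b.
Proof. by move=> sa ab bt; rewrite mulr_ge0 ?powR_ge0 ?G_mono. Qed.

Lemma delta_gauge a m b : s <= a -> a <= m -> m <= b -> b <= t ->
  `|A a b - A a m - A m b| <= K * gauge a b.
Proof.
move=> sa; rewrite le_eqVlt => /predU1P[<-|am] mb bt.
  by rewrite A_diag subr0 subrr normr0 mulr_ge0 ?gauge_ge0.
move: mb; rewrite le_eqVlt => /predU1P[mb|mb].
  rewrite mb A_diag subr0 subrr normr0 mulr_ge0 ?gauge_ge0//.
  by rewrite -mb ltW.
have ab := lt_trans am mb.
apply: le_trans (delta_desingularised sa am mb bt) _; rewrite ler_wpM2l//.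
have -> : (b - a) `^ mu = (b - a) * (b - a) `^ (mu - 1).
  by rewrite mulr_powRB1 ?subr_ge0 ?(ltW ab)// (lt_trans ltr01).
by rewrite /gauge mulrA [leRHS]mulrC ler_wpM2r ?powR_ge0// phi_G.
Qed.

(** Only the factor [(b - a) `^ (mu - 1)] gains from short intervals; the factor
    [G b - G a] is additive, hence it is enough to control lengths. *)
Lemma gauge_halves a x y b : s <= a -> a <= x -> x <= y -> y <= b -> b <= t ->
    2 * (x - a) <= b - a -> 2 * (b - y) <= b - a ->
  gauge a x + gauge y b <= theta * gauge a b.
Proof.
move: mu_gt1 => mu1 sa ax xy yb bt hx hy.
have Gax : 0 <= G x - G a by apply: G_mono => //; lra.
have Gxy : 0 <= G y - G x by apply: G_mono => //; lra.
have Gyb : 0 <= G b - G y by apply: G_mono => //; lra.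
have pow_half z : 0 <= z -> 2 * z <= b - a ->
    z `^ (mu - 1) <= theta * (b - a) `^ (mu - 1).
  move=> z0 hz; rewrite /halving_ratio -(opprB mu 1) -powR_half; last lra.
  by apply: ge0_ler_powR; rewrite ?nnegrE; lra.
have p0 : 0 <= theta * (b - a) `^ (mu - 1) by rewrite mulr_ge0 ?powR_ge0// ltW.
rewrite /gauge mulrA.
apply: (@le_trans _ _ (theta * (b - a) `^ (mu - 1) * (G x - G a)
    + theta * (b - a) `^ (mu - 1) * (G b - G y))).
  by apply: lerD; apply: ler_wpM2r => //; apply: pow_half => //; lra.
by rewrite -mulrDr ler_wpM2l//; lra.
Qed.

Lemma gauge_subr a x b : s <= a -> a <= x -> x <= b -> b <= t ->
  gauge x b <= gauge a b.
Proof.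
move: mu_gt1 => mu1 sa ax xb bt; have Gax := G_mono sa ax (le_trans xb bt).
apply: ler_pM; [exact: powR_ge0|apply: G_mono => //; lra| |lra].
by apply: ge0_ler_powR; rewrite ?nnegrE; lra.
Qed.

(** The interval [[x, y]] of the partition that contains the midpoint of [[a, b]]
    is isolated at the cost of two defects; the parts of the partition to its left
    and to its right live on intervals of at most half the length, so their
    errors, given by induction, sum to at most [halving_ratio] times the error
    that is allowed. *)
Lemma germ_sum_maximal a P : s <= a -> path <%R a P -> last a P <= t ->
  `|germ_sum A a P - A a (last a P)| <= M * gauge a (last a P).
Proof.
have [n] := ubnP (size P); elim: n a P => // n IH a P.
case: (eqVneq P [::]) => [-> _ sa _ at_|P0 sP sa aP bt].
  by rewrite germ_sum_nil A_diag subrr normr0 /gauge /= !subrr !mulr0.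
set b := last a P in bt *.
have ab : a < b.
  case: P P0 aP @b bt {sP} => // x P _ /= /andP[ax /path_lt_last xP] _.
  exact: lt_le_trans xP.
have hasb : has (fun x => a + b < 2 * x) P.
  apply/hasP; exists b; last lra.
  by case: P P0 @b {sP aP bt ab} => // x P _ /=; exact: mem_last.
move: sP aP (erefl b); rewrite {1}/b.
case/split_find: hasb => y P1 P2 hy; rewrite -all_predC => /allP hP1.
rewrite cat_rcons size_cat cat_path last_cat /= ltnS => sP /and3P[aP1 xy yP2] bE.
set x := last a P1 in xy bE *.
have ax : a <= x by apply: path_lt_last.
have x2 : 2 * x <= a + b.
  rewrite /x; case: (P1) hP1 => [|z Q] hz /=; first lra.
  by rewrite leNgt; apply: hz; rewrite /=; exact: mem_last.
have yb : y <= b by rewrite -bE; apply: path_lt_last.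
have IH1 : `|germ_sum A a P1 - A a x| <= M * gauge a x.
  by apply: IH => //; [rewrite (leq_trans _ sP)// addnS ltnS leq_addr|rewrite -/x; lra].
have IH2 : `|germ_sum A y P2 - A y b| <= M * gauge y b.
  by rewrite -bE; apply: IH => //; [exact: leq_trans (leq_addl _ _) sP|lra|rewrite bE].
have d1 := delta_gauge sa ax (ltW (lt_le_trans xy yb)) bt.
have sx : s <= x by lra.
have d2 := delta_gauge sx (ltW xy) yb bt.
have d3 : gauge x b <= gauge a b by apply: gauge_subr => //; lra.
have d4 : gauge a x + gauge y b <= theta * gauge a b.
  by apply: gauge_halves => //; lra.
rewrite germ_sum_cat germ_sum_cons -/x.
have -> : germ_sum A a P1 + (A x y + germ_sum A y P2) - A a b =
    (germ_sum A a P1 - A a x) + (germ_sum A y P2 - A y b)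
    - (A a b - A a x - A x b) - (A x b - A x y - A y b).
  rewrite -[RHS]addrA -opprD !addrA subrK opprB addrA subrK opprB addrA.
  rewrite opprB addrA -[X in X + A a x]addrA [X in X + A a x]addrAC subrK.
  by rewrite -addrA [A x y + _]addrC.
have mK : K * gauge x b <= K * gauge a b by rewrite ler_wpM2l.
have mM : M * gauge a x + M * gauge y b <= M * (theta * gauge a b).
  by rewrite -mulrDr ler_wpM2l// sewing_cst_ge0.
rewrite sewing_cst_eq// mulrDl -mulrA.
rewrite (_ : theta * M * gauge a b = M * (theta * gauge a b)); last by ring.
apply: le_trans (ler_normB _ _) _.
apply: le_trans (lerD (ler_normB _ _) (lexx _)) _.
apply: le_trans (lerD (lerD (ler_normD _ _) (lexx _)) (lexx _)) _.
lra.
Qed.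

(** The maximal inequality is applied in each interval of the coarse partition:
    the powers of the lengths are bounded by that of the mesh and the increments
    of [G] telescope. *)
Lemma germ_sum_refine a d P Q : s <= a -> path <%R a P -> path <%R a Q ->
    {subset P <= Q} -> last a Q = last a P -> last a P <= t -> mesh a P <= d ->
  `|germ_sum A a Q - germ_sum A a P|
    <= M * d `^ (mu - 1) * (G (last a P) - G a).
Proof.
elim: P a Q => [|x P IH] a Q sa.
  move=> _ aQ _ Qa _ _; rewrite (@itv_partitionxx _ _ a Q) ?subrr ?normr0 ?mulr0//.
  by split; last exact/eqP.
move=> /= /andP[ax xP] + PQ.
have xQ : x \in Q by rewrite PQ ?mem_head.
case/splitPr: Q / xQ PQ => Q1 Q2 PQ.
rewrite cat_path last_cat /= mesh_cons ge_max => /and3P[aQ1 Q1x xQ2] Q2P Pt.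
move=> /andP[xad Pd].
have xPt := path_lt_last xP.
have {}IH := IH x Q2 (le_trans sa (ltW ax)) xP xQ2 _ Q2P Pt Pd.
have PQ2 : {subset P <= Q2}.
  move=> z zP; have := PQ z; rewrite inE zP orbT => /(_ isT).
  have xz : x < z by have /allP := order_path_min lt_trans xP; apply.
  rewrite mem_cat inE (gt_eqF xz) /= => /orP[zQ1|//].
  case/splitPr: Q1 / zQ1 aQ1 Q1x {PQ} => Z1 Z2.
  rewrite cat_path last_cat /= => /and3P[_ _ /path_lt_last zl] lx.
  by have := lt_le_trans xz (le_trans zl (ltW lx)); rewrite ltxx.
have ax_le : `|germ_sum A a (rcons Q1 x) - A a x|
    <= M * d `^ (mu - 1) * (G x - G a).
  have := @germ_sum_maximal a (rcons Q1 x) sa.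
  rewrite rcons_path aQ1 Q1x last_rcons => /(_ isT (le_trans xPt Pt)).
  move=> /le_trans; apply; rewrite -mulrA ler_wpM2l ?sewing_cst_ge0//.
  rewrite /gauge ler_wpM2r ?G_mono ?(ltW ax) ?(le_trans xPt)//.
  move: mu_gt1 => mu1.
  by apply: ge0_ler_powR; rewrite ?nnegrE; lra.
rewrite -cat_rcons germ_sum_cat last_rcons germ_sum_cons opprD addrACA.
apply: le_trans (ler_normD _ _) _.
apply: le_trans (lerD ax_le (IH PQ2)) _.
by rewrite -mulrDr [X in _ * X]addrC addrA subrK.
Qed.

Lemma germ_sum_cauchy d P Q : s < t ->
    itv_partition s t P -> itv_partition s t Q -> mesh s P <= d -> mesh s Q <= d ->
  `|germ_sum A s P - germ_sum A s Q| <= 2 * (M * d `^ (mu - 1) * (G t - G s)).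
Proof.
move=> st hP hQ Pd Qd.
have [Z [[sZ /eqP Zt] PZ QZ]] := common_refinement st hP hQ.
case: hP hQ => sP /eqP Pt [sQ /eqP Qt].
have hP : `|germ_sum A s Z - germ_sum A s P| <= M * d `^ (mu - 1) * (G t - G s).
  by rewrite -[in leRHS]Pt; apply: germ_sum_refine; rewrite ?Pt ?Zt.
have hQ : `|germ_sum A s Z - germ_sum A s Q| <= M * d `^ (mu - 1) * (G t - G s).
  by rewrite -[in leRHS]Qt; apply: germ_sum_refine; rewrite ?Qt ?Zt.
apply: le_trans (ler_distD (germ_sum A s Z) _ _) _.
by rewrite (distrC _ (germ_sum A s Z)); lra.
Qed.

Lemma germ_sum_cvg : s < t ->
  exists2 y : W, germ_sum A s P @[P --> fine_partitions s t] --> y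
               & `|y - A s t| <= M * gauge s t.
Proof.
move=> st; have FF := fine_partitions_proper st.
have M0 := sewing_cst_ge0 mu_gt1.
have Gst : 0 <= G t - G s by apply: G_mono => //; exact: ltW.
have cvg_sum : cvg (germ_sum A s P @[P --> fine_partitions s t]).
  apply/cauchy_cvgP/cauchy_exP => e e0.
  have c0 : 0 <= 2 * (M * (G t - G s)) by rewrite mulr_ge0// mulr_ge0.
  have p0 : 0 < mu - 1 by rewrite subr_gt0.
  have [d d0 hd] := small_powR p0 c0 e0.
  have [Q hQ Qd] := exists_fine_partition st d0.
  exists (germ_sum A s Q); exists d => //= P hP Pd.
  rewrite -ball_normE /ball_ /=.
  apply: le_lt_trans (germ_sum_cauchy st hQ hP (ltW Qd) (ltW Pd)) _.
  by apply: le_lt_trans hd; rewrite le_eqVlt; apply/orP; left; apply/eqP; ring.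
exists (lim (germ_sum A s P @[P --> fine_partitions s t])) => //.
set y := lim _ in cvg_sum *.
apply/ler_addgt0Pr => e e0.
have /cvgrPdist_le/(_ _ e0) [d d0 hd] := cvg_sum.
have [Q hQ Qd] := exists_fine_partition st d0.
have {}hd : `|y - germ_sum A s Q| <= e := hd _ hQ Qd.
case: hQ => sQ /eqP Qt.
have hM := @germ_sum_maximal s Q (lexx s) sQ; rewrite Qt in hM.
rewrite [leRHS]addrC; apply: le_trans (ler_distD (germ_sum A s Q) _ _) _.
by rewrite lerD// hM.
Qed.

End Germ.

(** For a combination of powers the weight is [phi], and [G] is the primitive of
    [phi] that vanishes at [t]. *)
Section PowerWeights.
Context {R : realType} {W : completeNormedModType R} (J : finType).
Variables (A : R -> R -> W) (s t mu : R) (k g : J -> R).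
Hypothesis mu_gt1 : 1 < mu.
Hypothesis st : s < t.
Hypothesis k_ge0 : forall i, 0 <= k i.
Hypothesis g_ge0 : forall i, 0 <= g i.
Hypothesis g_lt1 : forall i, g i < 1.
Hypothesis A_diag : forall a, A a a = 0.
Hypothesis A_delta : forall a m b, s <= a -> a < m -> m < b -> b <= t ->
  `|A a b - A a m - A m b|
    <= (\sum_(i : J) k i * (t - m) `^ (- g i)) * (b - a) `^ mu.

Let phi u : R := \sum_(i : J) k i * (t - u) `^ (- g i).
Let G u : R := - \sum_(i : J) k i / (1 - g i) * (t - u) `^ (1 - g i).

Theorem singular_sewing :
  exists2 y : W, germ_sum A s P @[P --> fine_partitions s t] --> y
    & `|y - A s t| <=
       sewing_cst mu * \sum_(i : J) k i / (1 - g i) * (t - s) `^ (mu - g i).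
Proof.
have phi_ge0 a : s <= a -> a < t -> 0 <= phi a.
  by move=> _ _; apply: sumr_ge0 => i _; rewrite mulr_ge0 ?powR_ge0.
have phi_double a m : s <= a -> a <= m -> m < t -> 2 * m <= a + t ->
    phi m <= 2 * phi a.
  move=> sa am mt m2; rewrite /phi mulr_sumr; apply: ler_sum => i _.
  rewrite mulrCA ler_wpM2l//.
  apply: (@le_trans _ _ (((t - a) / 2) `^ (- g i))).
    by apply: powR_antitone => //; lra.
  rewrite powR_half; last lra.
  rewrite opprK ler_wpM2r ?powR_ge0//.
  by have := @ler_powR _ (2 : R) _ (g i) 1; rewrite powRr1//; apply; [lra|exact: ltW].
have phi_G a b : s <= a -> a < b -> b <= t -> phi a * (b - a) <= G b - G a.
  move=> sa ab bt; rewrite /G opprK [leRHS]addrC -sumrB /phi mulr_suml.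
  apply: ler_sum => i _; rewrite -mulrBr -!mulrA ler_wpM2l//.
  rewrite -ler_pdivrMl ?invr_gt0 ?subr_gt0// invrK.
  have -> : b - a = (t - a) - (t - b) by ring.
  by apply: powR_concave => //; lra.
have [y y_lim y_le] := germ_sum_cvg mu_gt1 A_diag phi_ge0 phi_double phi_G A_delta st.
exists y => //; apply: le_trans y_le _.
rewrite ler_wpM2l ?sewing_cst_ge0// le_eqVlt; apply/orP; left; apply/eqP.
rewrite /gauge /G opprK subrr big1 ?oppr0 ?add0r => [|i _]; last first.
  by rewrite powR0 ?mulr0// gt_eqF// subr_gt0.
rewrite mulr_sumr; apply: eq_bigr => i _; rewrite mulrCA -powRD.
  by congr (_ * _ `^ _); ring.
by rewrite subr_eq0 (gt_eqF st) implybT.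
Qed.

End PowerWeights.

(** * Limits at 0 from estimates on dyadic windows *)
Section DyadicLimit.
Context {R : realType} {W : completeNormedModType R}.
Variables (K : finType) (c p : K -> R) (r : R) (F : R -> W).
Hypothesis r_gt0 : 0 < r.
Hypothesis c_ge0 : forall j, 0 <= c j.
Hypothesis p_gt0 : forall j, 0 < p j.
Hypothesis F_step : forall s s', 0 < s' -> s <= 2 * s' -> s' < s -> s <= r ->
  `|F s' - F s| <= \sum_(j : K) c j * s `^ p j.

(** The sum of the bounds [c j * s `^ p j] over [s], [s / 2], [s / 4] and so on. *)
Definition dyadic_total (s : R) : R :=
  \sum_(j : K) c j / (1 - 2 `^ (- p j)) * s `^ p j.

Let geom_gt0 j : 0 < 1 - 2 `^ (- p j) :> R.
Proof. by rewrite subr_gt0 two_powR_lt1// oppr_lt0. Qed.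

Lemma dyadic_total_half s : 0 <= s ->
  dyadic_total (s / 2) + \sum_(j : K) c j * s `^ p j = dyadic_total s.
Proof.
move=> s0; rewrite /dyadic_total -big_split; apply: eq_bigr => j _ /=.
rewrite powR_half//; field; exact: lt0r_neq0.
Qed.

Lemma dyadic_total_ge0 s : 0 <= dyadic_total s.
Proof.
apply: sumr_ge0 => j _; rewrite mulr_ge0 ?powR_ge0// divr_ge0//.
exact: ltW.
Qed.

Lemma dyadic_total_bound s s' : 0 < s' -> s' < s -> s <= r ->
  `|F s' - F s| <= dyadic_total s.
Proof.
move=> s'0 s's; have [n] : exists n : nat, s <= 2 ^+ n * s'.
  exists (Num.bound (s / s')).
  rewrite -ler_pdivrMr//; apply: le_trans (ltW (archi_boundP _)) _.
    by apply: divr_ge0; lra.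
  by rewrite -natrX ler_nat ltnW// ltn_expl.
elim: n s s's => [|n IH] s s's; first by rewrite expr0 mul1r; lra.
rewrite exprS => sn sr; have s0 : 0 < s := lt_trans s'0 s's.
have s20 : 0 <= s / 2 by lra.
rewrite -(dyadic_total_half (ltW s0)).
have [s2|s2] := leP s (2 * s').
  apply: le_trans (F_step s'0 s2 s's sr) _.
  by rewrite lerDr dyadic_total_ge0.
apply: le_trans (ler_distD (F (s / 2)) _ _) _; apply: lerD.
  by apply: IH; lra.
by apply: F_step; lra.
Qed.

(** Since [dyadic_total s] tends to 0 with [s], the bound
    [dyadic_total_bound], uniform in [s'], is a Cauchy estimate. *)
Lemma dyadic_limit :
  exists2 l : W, F s @[s --> 0^'+] --> l & `|l - F r| <= dyadic_total r.
Proof.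
have total0 : dyadic_total s @[s --> 0^'+] --> 0.
  rewrite [X in _ --> X](_ : _ = \sum_(j : K) c j / (1 - 2 `^ (- p j)) * 0).
    apply: (cvg_big add_continuous) => j _.
    by apply: cvgMl_tmp; exact: powR_cvg0.
  by rewrite big1// => j _; rewrite mulr0.
have F_cvg : cvg (F s @[s --> 0^'+]).
  apply/cauchy_cvgP/cauchy_exP => e e0.
  have [s [s0 sr se]] : exists s, [/\ 0 < s, s <= r & dyadic_total s < e].
    have /cvgr0Pnorm_lt/(_ _ e0) total_e := total0.
    near (0 : R)^'+ => s; exists s; split=> //.
      by near: s; exact: nbhs_right_le.
    by rewrite -[ltLHS]ger0_norm ?dyadic_total_ge0//; near: s.
  exists (F s); change (\forall x \near 0^'+, ball (F s) e (F x)).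
  apply: filterS2 (nbhs_right_gt 0) (nbhs_right_lt s0) => x x0 xs.
  rewrite -ball_normE /= distrC; apply: le_lt_trans se.
  exact: dyadic_total_bound.
exists (lim (F s @[s --> 0^'+])) => //; apply/ler_addgt0Pr => e e0.
have /cvgrPdist_le/(_ _ e0) F_lim := F_cvg.
near (0 : R)^'+ => s.
rewrite [leRHS]addrC; apply: le_trans (ler_distD (F s) _ _) _.
apply: lerD; first by near: s.
apply: dyadic_total_bound => //.
Unshelve. all: by end_near.
Qed.

End DyadicLimit.

(** * Norms of the scale, read in the ambient space *)
Section ScaleNorm.
Context {R : realType} {E : lmodType R}.
Context {V : R -> R -> completeNormedModType R}.
Variables (T : R) (inj : forall a t : R, {linear V a t -> E}).
Implicit Types (a b s t : R) (x y : E).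

Lemma norm_le_weaken a t x (M N : R) :
  M <= N -> norm_le inj a t x M%:E -> norm_le inj a t x N%:E.
Proof.
move=> MN [y yx yM]; exists y => //.
by rewrite !lee_fin in yM *; exact: le_trans MN.
Qed.

Lemma norm_leD a t x y (M N : R) : norm_le inj a t x M%:E ->
  norm_le inj a t y N%:E -> norm_le inj a t (x + y) (M + N)%:E.
Proof.
move=> [u <- uM] [v <- vN]; exists (u + v); first by rewrite linearD.
by rewrite !lee_fin in uM vN *; rewrite (le_trans (ler_normD _ _))// lerD.
Qed.

Lemma norm_leN a t x (M : R) :
  norm_le inj a t x M%:E -> norm_le inj a t (- x) M%:E.
Proof. by move=> [u <- uM]; exists (- u); rewrite ?linearN// normrN. Qed.

Lemma norm_leB a t x y (M N : R) : norm_le inj a t x M%:E ->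
  norm_le inj a t y N%:E -> norm_le inj a t (x - y) (M + N)%:E.
Proof. by move=> hx /norm_leN; exact: norm_leD. Qed.

Lemma norm_le_sum (J : finType) a t (x : J -> E) (M : J -> R) :
    (forall i, norm_le inj a t (x i) (M i)%:E) ->
  norm_le inj a t (\sum_(i : J) x i) (\sum_(i : J) M i)%:E.
Proof.
move=> h; elim/big_ind2 : _ => [|u p v q hu hv|i _]; last exact: h.
- by exists 0; rewrite ?linear0 ?normr0.
- exact: norm_leD.
Qed.

Hypothesis nested : nested_scale T inj.

Lemma norm_le_embed a b s t x (M : R) : 0 <= s -> s <= t -> t <= T ->
  a <= b -> norm_le inj b s x M%:E -> norm_le inj a t x M%:E.
Proof.
move=> s0 st tT ab [u <- uM].
have [v vu vn] := nested.2 a b s t s0 st tT ab u.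
by exists v => //; exact: le_trans uM.
Qed.

Lemma norm_le_inj a t (u : V a t) (M : R) : 0 <= t -> t <= T ->
  norm_le inj a t (inj a t u) M%:E -> `|u| <= M.
Proof.
move=> t0 tT [v vu vM]; have {vu} vu := nested.1 a t t0 tT _ _ vu.
by rewrite vu lee_fin in vM.
Qed.

Lemma norm_le_arbitrary a t x : 0 <= t -> t <= T ->
  (forall e : R, 0 < e -> norm_le inj a t x e%:E) -> x = 0.
Proof.
move=> t0 tT h; have [u ux _] := h 1 ltr01.
suff u0 : u = 0 by rewrite -ux u0 linear0.
apply/eqP; rewrite -normr_le0; apply/ler_addgt0Pr => e e0.
by rewrite add0r; apply: (norm_le_inj t0 tT); rewrite ux; exact: h.
Qed.

Variable S : R -> {linear E -> E}.

(** The interval [[al - 1, al]] contains all regularities [al - rho i], and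
    [[0, B]] all the gains that occur, so that one constant serves throughout. *)
Definition smoothing_with (al B C : R) : Prop :=
  forall a b t tau x (M : R), al - 1 <= a -> a <= al -> 0 <= b -> b <= B ->
    0 < t -> t <= T -> 0 <= tau -> tau <= T -> norm_le inj a tau x M%:E ->
    norm_le inj (a + b) tau (S t x) (C * t `^ (- b) * M)%:E.

Lemma smoothing_bounded (al B C t tau : R) x (M : R) :
    smoothing_with al B C -> 0 <= B -> 0 < t -> t <= T -> 0 <= tau -> tau <= T ->
  norm_le inj al tau x M%:E -> norm_le inj al tau (S t x) (C * M)%:E.
Proof.
move=> smooth B0 t0 tT tau0 tauT hx.
have : norm_le inj (al + 0) tau (S t x) (C * t `^ (- 0) * M)%:E.
  by apply: smooth => //; lra.
by rewrite oppr0 powRr0 mulr1 addr0.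
Qed.

Hypothesis smooth : smoothing T inj S.

Lemma smoothing_uniform (al B : R) :
  exists2 C : R, 0 <= C & smoothing_with al B C.
Proof.
have [C hC] := smooth (@segment_compact R (al - 1) al) (@segment_compact R 0 B).
exists (Num.max C 0); first by rewrite le_max lexx orbT.
move=> a b t tau x M a1 a2 b0 bB t0 tT tau0 tauT [u <- uM].
have h : norm_le inj (a + b) tau (S t (inj a tau u)) (C * t `^ (- b) * `|u|)%:E.
  by apply: hC => //=; rewrite in_itv/=; apply/andP.
apply: norm_le_weaken h; rewrite lee_fin in uM.
apply: (@le_trans _ _ (Num.max C 0 * t `^ (- b) * `|u|)).
  by rewrite ler_wpM2r// ler_wpM2r ?powR_ge0// le_max lexx.
by rewrite ler_wpM2l// mulr_ge0 ?powR_ge0// le_max lexx orbT.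
Qed.

End ScaleNorm.

Lemma subintervals_between (R : realType) (s : R) P uv :
  path <%R s P -> uv \in subintervals s P ->
  [/\ s <= uv.1, uv.1 < uv.2 & uv.2 <= last s P].
Proof.
elim: P s => // x P IH s /= /andP[sx xP].
rewrite /subintervals /= inE => /predU1P[->|uvP] /=.
  by split=> //; exact: path_lt_last.
have [h1 h2 h3] := IH x xP uvP.
by split=> //; exact: le_trans (ltW sx) h1.
Qed.

(** * Limits of sewing sums *)
Section SewingLimits.
Context {R : realType} {E : lmodType R}.
Context {V : R -> R -> completeNormedModType R}.
Variables (T : R) (inj : forall a t : R, {linear V a t -> E}).
Variable S : R -> {linear E -> E}.
Hypothesis nested : nested_scale T inj.
Hypothesis semi : semigroup S.
Variables (al : R) (Xi : forall t : R, R -> V al t).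

(** Convergence of the sums expressed in the ambient space, so that limits taken
    in different spaces of the scale can be compared and transported. *)
Definition sums_tend_to (a t s : R) (x : E) : Prop :=
  forall e : R, 0 < e -> exists2 d : R, 0 < d &
    forall P, itv_partition s t P -> mesh s P < d ->
      norm_le inj a t (sewing_sum inj S Xi t s P - x) e%:E.

Lemma sums_tend_to_unique a t s x y : 0 < s -> s < t -> t <= T ->
  sums_tend_to a t s x -> sums_tend_to a t s y -> x = y.
Proof.
move=> s0 st tT hx hy; apply/eqP; rewrite -subr_eq0; apply/eqP.
apply: (norm_le_arbitrary nested (a := a) (t := t)) => //; first lra.
move=> e e0; have e2 : 0 < e / 2 by lra.
have [d1 d10 h1] := hx _ e2; have [d2 d20 h2] := hy _ e2.
have d0 : 0 < Num.min d1 d2 by rewrite lt_min d10.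
have [P hP] := exists_fine_partition st d0; rewrite lt_min => /andP[Pd1 Pd2].
have := norm_leB (h2 P hP Pd2) (h1 P hP Pd1).
by rewrite opprB [_ - y + _]addrC addrA subrK -splitr.
Qed.

Lemma sums_tend_to_embed a b t s x : 0 <= t -> t <= T -> a <= b ->
  sums_tend_to b t s x -> sums_tend_to a t s x.
Proof.
move=> t0 tT ab h e /h[d d0 hd]; exists d => // P hP Pd.
by apply: (norm_le_embed nested (b := b) (s := t)) => //; exact: hd.
Qed.

Lemma sewing_limit_tends (t s : R) (x : V al t) :
  sewing_limit inj S Xi s x -> sums_tend_to al t s (inj al t x).
Proof.
move=> [sm smE /cvgrPdist_le sm_cvg] e e0.
have [d d0 hd] := sm_cvg e e0; exists d => // P hP Pd.
exists (sm P - x); first by rewrite linearB smE.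
by rewrite lee_fin distrC; exact: hd.
Qed.

Lemma tends_sewing_limit (t s : R) (x : V al t) : 0 <= t -> t <= T ->
    (forall P, itv_partition s t P ->
       exists z : V al t, inj al t z = sewing_sum inj S Xi t s P) ->
  sums_tend_to al t s (inj al t x) -> sewing_limit inj S Xi s x.
Proof.
move=> t0 tT ex_sum h.
have ex P : exists z : V al t, itv_partition s t P ->
    inj al t z = sewing_sum inj S Xi t s P.
  by have [/ex_sum[z hz]|nP] := pselect (itv_partition s t P);
    [exists z|exists 0].
have [sm smE] := choice ex.
exists sm => //; apply/cvgrPdist_le => e /h[d d0 hd].
exists d => // P hP Pd.
rewrite distrC; apply: (norm_le_inj nested t0 tT).
by rewrite linearB smE//; exact: hd.
Qed.

Lemma sewing_sum_cat (t u s : R) (P Q : seq R) :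
    itv_partition s u P -> u <= t ->
  sewing_sum inj S Xi t s (P ++ Q)
    = S (t - u) (sewing_sum inj S Xi u s P) + sewing_sum inj S Xi t u Q.
Proof.
move=> [sP /eqP Pu] ut.
rewrite -[LHS]/(germ_sum (fun u v => S (t - v) (inj al v (Xi v u))) s (P ++ Q)).
rewrite germ_sum_cat Pu; congr (_ + _).
rewrite /germ_sum /sewing_sum linear_sum; apply: eq_big_seq => -[p q] /=.
move=> /(subintervals_between sP)[/= _ _]; rewrite Pu => qu.
by rewrite -semi.2 ?subr_ge0// addrA subrK.
Qed.

Variables (B C : R).
Hypothesis smooth : smoothing_with T inj S al B C.
Hypothesis B_ge0 : 0 <= B.

(** Sums over concatenated partitions of [[s, u]] and [[u, t]] are particular sums
    over [[s, t]], and [S (t - u)] is bounded on [V al t]. *)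
Lemma sums_tend_to_additive (t u s : R) x y z :
    0 < s -> s < u -> u < t -> t <= T ->
    sums_tend_to al t s x -> sums_tend_to al t u y -> sums_tend_to al u s z ->
  x = y + S (t - u) z.
Proof.
move=> s0 su ut tT hx hy hz; apply/eqP; rewrite -subr_eq0; apply/eqP.
apply: (norm_le_arbitrary nested (a := al) (t := t)) => //; first lra.
move=> e e0; pose f := e / (`|C| + 2).
have C2 : 0 < `|C| + 2 by rewrite ltr_wpDl.
have f0 : 0 < f by rewrite divr_gt0.
have [d1 d10 h1] := hx _ f0; have [d2 d20 h2] := hy _ f0.
have [d3 d30 h3] := hz _ f0.
have d130 : 0 < Num.min d1 d3 by rewrite lt_min d10.
have d120 : 0 < Num.min d1 d2 by rewrite lt_min d10.
have [P hP] := exists_fine_partition su d130; rewrite lt_min => /andP[Pd1 Pd3].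
have [Q hQ] := exists_fine_partition ut d120; rewrite lt_min => /andP[Qd1 Qd2].
have hPQ : itv_partition s t (P ++ Q) by apply: itv_partition_cat hP hQ.
have PQd : mesh s (P ++ Q) < d1.
  by rewrite mesh_cat gt_max Pd1; case: hP => _ /eqP ->.
have k1 := h1 _ hPQ PQd; have k2 := h2 _ hQ Qd2; have k3 := h3 _ hP Pd3.
have k4 : norm_le inj al t
    (S (t - u) (sewing_sum inj S Xi u s P - z)) (C * f)%:E.
  apply: (smoothing_bounded smooth); rewrite ?subr_gt0//; [lra|lra|].
  by apply: (norm_le_embed nested (b := al) (s := u)) => //; lra.
have := norm_leB (norm_leD k2 k4) k1.
rewrite (sewing_sum_cat _ hP (ltW ut)) linearB.
set p := S _ _; set q := sewing_sum _ _ _ _ _ _; set r := S _ z.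
rewrite (_ : _ - (_ - x) = x - (y + r)); last first.
  by rewrite opprB [LHS]addrC [q - y + _]addrACA -opprD [q + p]addrC addrA subrK.
apply: norm_le_weaken.
have -> : f + C * f + f = (C + 2) * f by ring.
rewrite -[leRHS](mulfVK (lt0r_neq0 C2)) -/f.
by rewrite mulrC ler_wpM2l ?(ltW f0)// lerD2r ler_norm.
Qed.

End SewingLimits.

(** * Sewing in the scale *)
Section SeminormBounds.
Context {R : realType} {V : R -> R -> completeNormedModType R}.
Variables (T al mu sigma eta1 : R) (J : finType) (rho eta2 : J -> R).
Hypothesis T_gt0 : 0 < T.

Lemma seminorm2_bound (Xit : forall t : R, R -> V al t) :
    (seminorm2 T sigma eta1 Xit < +oo)%E ->
  exists N : R, [/\ 0 <= N, seminorm2 T sigma eta1 Xit = N%:E &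
    forall s t, 0 < s -> s < t -> t <= T ->
      `|Xit t s| <= N * (s `^ (- eta1) * (t - s) `^ sigma)].
Proof.
move: T_gt0 => T0; have T2 : 0 < T / 2 by lra.
have T2T : T / 2 < T by lra.
set sn := seminorm2 _ _ _ _ => fin.
have le_sn s t : 0 < s -> s < t -> t <= T ->
    ((`|Xit t s| / (s `^ (- eta1) * `|s - t| `^ sigma))%:E <= sn)%E.
  by move=> s0 st tT; apply: ereal_sup_ubound; exists s, t.
have sn0 : (0 <= sn)%E.
  apply: le_trans (le_sn _ _ T2 T2T (lexx T)).
  by rewrite lee_fin divr_ge0// mulr_ge0 ?powR_ge0.
have snE : sn = (fine sn)%:E by rewrite fineK// ge0_fin_numE.
exists (fine sn); split=> //; first exact: fine_ge0.
move=> s t s0 st tT; have := le_sn s t s0 st tT.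
rewrite snE lee_fin distrC gtr0_norm ?subr_gt0// ler_pdivrMr//.
by rewrite mulr_gt0// powR_gt0// subr_gt0.
Qed.

Lemma seminorm3_bound (Xid : forall (i : J) (t : R), R -> R -> V (al - rho i) t) :
    (seminorm3 T mu eta2 Xid < +oo)%E ->
  exists N : R, [/\ 0 <= N, seminorm3 T mu eta2 Xid = N%:E &
    forall i s u t, 0 < s -> s < u -> u < t -> t <= T ->
      `|Xid i t u s| <= N * ((t - s) `^ mu * s `^ (- eta2 i))].
Proof.
move: T_gt0 => T0; have T3 : 0 < T / 3 by lra.
have T3T2 : T / 3 < T / 2 by lra.
have T2T : T / 2 < T by lra.
set sn := seminorm3 _ _ _ _ => fin.
pose term (i : J) := ereal_sup [set x | exists s u t : R,
  [/\ 0 < s, s < u, u < t, t <= T &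
   x = (`|Xid i t u s| / (`|t - s| `^ mu * s `^ (- eta2 i)))%:E]].
have sn_sum : sn = (\sum_(i : J) term i)%E by [].
have le_term i s u t : 0 < s -> s < u -> u < t -> t <= T ->
    ((`|Xid i t u s| / (`|t - s| `^ mu * s `^ (- eta2 i)))%:E <= term i)%E.
  by move=> s0 su ut tT; apply: ereal_sup_ubound; exists s, u, t.
have term0 i : (0 <= term i)%E.
  apply: le_trans (le_term i _ _ _ T3 T3T2 T2T (lexx T)).
  by rewrite lee_fin divr_ge0// mulr_ge0 ?powR_ge0.
have sn0 : (0 <= sn)%E by rewrite sn_sum sume_ge0.
have term_sn i : (term i <= sn)%E.
  by rewrite sn_sum (bigD1 i)//= leeDl// sume_ge0.
have snE : sn = (fine sn)%:E by rewrite fineK// ge0_fin_numE.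
exists (fine sn); split=> //; first exact: fine_ge0.
move=> i s u t s0 su ut tT.
have := le_trans (le_term i s u t s0 su ut tT) (term_sn i).
have ts : 0 < t - s by lra.
rewrite snE lee_fin gtr0_norm// ler_pdivrMr//.
by rewrite mulr_gt0// powR_gt0.
Qed.

End SeminormBounds.

Section GermLimits.
Context {R : realType} {E : lmodType R}.
Context {V : R -> R -> completeNormedModType R}.
Variables (T : R) (inj : forall a t : R, {linear V a t -> E}).
Variable S : R -> {linear E -> E}.
Hypothesis nested : nested_scale T inj.
Hypothesis semi : semigroup S.
Variables (J : finType) (al mu sigma eta1 : R) (eta2 rho : J -> R).
Hypothesis mu_gt1 : 1 < mu.
Hypothesis eta2_ge0 : forall i, 0 <= eta2 i.
Hypothesis rho_ge0 : forall i, 0 <= rho i.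
Hypothesis rho_lt1 : forall i, rho i < 1.
Variables (B C : R).
Hypothesis C_ge0 : 0 <= C.
Hypothesis smooth : smoothing_with T inj S al B C.
Variables (Xi Xit : forall t : R, R -> V al t).
Variable Xid : forall (i : J) (t : R), R -> R -> V (al - rho i) t.
Hypothesis XiE : forall s t : R, 0 < s -> s < t -> t <= T ->
  inj al t (Xi t s) = S (t - s) (inj al t (Xit t s)).
Hypothesis deltaXiE : forall s u t : R, 0 < s -> s < u -> u < t -> t <= T ->
  hdelta inj S Xi t u s =
    \sum_(i : J) S (t - u) (inj (al - rho i) t (Xid i t u s)).
Variable N : R.
Hypothesis N_ge0 : 0 <= N.
Hypothesis Xid_le : forall i s u t, 0 < s -> s < u -> u < t -> t <= T ->
  `|Xid i t u s| <= N * ((t - s) `^ mu * s `^ (- eta2 i)).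
Section Gain.
Variable be : R.
Hypothesis be_ge0 : 0 <= be.
Hypothesis be_leB : be <= B.
Hypothesis be_rho_leB : forall i, be + rho i <= B.
Hypothesis be_rho : forall i, be + rho i < 1.

(** The representation of [Xi v u] as [S (v - u)] applied to an element of
    [V al v] leaves the semigroup a positive time [t - u] to regularise, even for
    [v = t]: the germ takes its values in every space [V (al + be) t]. *)
Lemma germ_smooth (t u v : R) : 0 < u -> u < v -> v <= t -> t <= T ->
  exists z : V (al + be) t, inj (al + be) t z = S (t - v) (inj al v (Xi v u)).
Proof.
move=> u0 uv vt tT; rewrite XiE//; last exact: le_trans tT.
rewrite -semi.2 ?subr_ge0 ?(ltW uv)// addrA subrK.
have h : norm_le inj al t (inj al v (Xit v u)) (`|Xit v u|)%:E.
  by apply: (norm_le_embed nested (b := al) (s := v)) => //; [lra|exists (Xit v u)].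
have [z zE _] : norm_le inj (al + be) t (S (t - u) (inj al v (Xit v u)))
    (C * (t - u) `^ (- be) * `|Xit v u|)%:E.
  by apply: smooth => //; lra.
by exists z.
Qed.

(** The operator [S (b - m)] in the decomposition of the defect of [Xi] combines
    with [S (t - b)] to [S (t - m)]: the time [t - m] available for regularisation
    produces the singular weight. *)
Lemma germ_delta (t a m b : R) : 0 < a -> a < m -> m < b -> b <= t -> t <= T ->
  norm_le inj (al + be) t (S (t - b) (inj al b (Xi b a))
    - S (t - m) (inj al m (Xi m a)) - S (t - b) (inj al b (Xi b m)))
  ((\sum_(i : J) (C * N * a `^ (- eta2 i)) * (t - m) `^ (- (be + rho i)))
     * (b - a) `^ mu)%:E.
Proof.
move=> a0 am mb bt tT; have bT := le_trans bt tT.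
have -> : S (t - b) (inj al b (Xi b a)) - S (t - m) (inj al m (Xi m a))
    - S (t - b) (inj al b (Xi b m))
    = \sum_(i : J) S (t - m) (inj (al - rho i) b (Xid i b m a)).
  transitivity (S (t - b) (hdelta inj S Xi b m a)).
    rewrite /hdelta !linearB /= -semi.2 ?subr_ge0 ?(ltW mb)//.
    by rewrite addrA subrK [LHS]addrAC.
  rewrite deltaXiE// linear_sum; apply: eq_bigr => i _.
  by rewrite -semi.2 ?subr_ge0 ?(ltW mb)// addrA subrK.
rewrite mulr_suml; apply: norm_le_sum => i.
rewrite (_ : al + be = al - rho i + (be + rho i)); last by ring.
have h : norm_le inj (al - rho i) t (inj (al - rho i) b (Xid i b m a))
    (N * ((b - a) `^ mu * a `^ (- eta2 i)))%:E.
  apply: (norm_le_embed nested (b := al - rho i) (s := b)) => //; first lra.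
  by exists (Xid i b m a) => //; rewrite lee_fin; exact: Xid_le.
rewrite (_ : _ * _ = C * (t - m) `^ (- (be + rho i))
    * (N * ((b - a) `^ mu * a `^ (- eta2 i)))); last by ring.
have r0 := rho_ge0 i; have r1 := rho_lt1 i; have bB := be_rho_leB i.
have b0 := be_ge0.
by apply: smooth => //; lra.
Qed.

Definition sewing_error_cst : R :=
  sewing_cst mu * C * \sum_(i : J) (1 - (be + rho i))^-1.

Lemma sewing_error_cst_ge0 : 0 <= sewing_error_cst.
Proof.
rewrite /sewing_error_cst mulr_ge0 ?(mulr_ge0 (sewing_cst_ge0 mu_gt1))//.
apply: sumr_ge0 => i _.
by rewrite invr_ge0 subr_ge0 ltW.
Qed.

(** The lemma on singular germs is applied in [V (al + be) t] with the weights
    [(t - m) `^ (- (be + rho i))]. The blow-up in the left end point of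
    subintervals is bounded by its value at [s]. *)
Theorem sewing_in_scale (t s : R) : 0 < s -> s < t -> t <= T ->
  exists y : V (al + be) t, [/\
    forall P, itv_partition s t P -> exists z : V (al + be) t,
      inj (al + be) t z = sewing_sum inj S Xi t s P,
    sums_tend_to inj S Xi (al + be) t s (inj (al + be) t y) &
    norm_le inj (al + be) t (inj (al + be) t y - inj al t (Xi t s))
      (sewing_error_cst * N *
        \sum_(i : J) s `^ (- eta2 i) * (t - s) `^ (mu - rho i - be))%:E].
Proof.
move=> s0 st tT; have t0 : 0 <= t by lra.
pose ok u v := [&& 0 < u, u < v & v <= t].
(* extended by 0, so that the germ vanishes on degenerate intervals *)
have exA uv : exists z : V (al + be) t, if ok uv.1 uv.2
    then inj (al + be) t z = S (t - uv.2) (inj al uv.2 (Xi uv.2 uv.1))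
    else z = 0.
  case: uv => u v /=.
  have [/and3P[u0 uv vt]|_] := boolP (ok u v); last by exists 0.
  exact: germ_smooth.
have [A' hA] := choice exA; pose A u v := A' (u, v).
have AE u v : 0 < u -> u < v -> v <= t ->
    inj (al + be) t (A u v) = S (t - v) (inj al v (Xi v u)).
  by move=> u0 uv vt; have := hA (u, v); rewrite /ok/= u0 uv vt.
have A_diag a : A a a = 0 by have := hA (a, a); rewrite /ok/= ltxx andbF.
pose k i := C * N * s `^ (- eta2 i).
have k_ge0 i : 0 <= k i by rewrite !mulr_ge0 ?powR_ge0.
have g_ge0 i : 0 <= be + rho i by rewrite addr_ge0.
have A_delta a m b : s <= a -> a < m -> m < b -> b <= t ->
    `|A a b - A a m - A m b|
      <= (\sum_(i : J) k i * (t - m) `^ (- (be + rho i))) * (b - a) `^ mu.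
  move=> sa am mb bt; apply: (norm_le_inj nested t0 tT).
  rewrite !linearB !AE; [|lra..].
  apply: norm_le_weaken (germ_delta _ am mb bt tT); last lra.
  rewrite ler_wpM2r ?powR_ge0//; apply: ler_sum => i _.
  rewrite ler_wpM2r ?powR_ge0// ler_wpM2l ?mulr_ge0//.
  exact: powR_antitone.
have [y y_lim y_le] := singular_sewing mu_gt1 st k_ge0 g_ge0 be_rho A_diag A_delta.
have sumE P : itv_partition s t P ->
    inj (al + be) t (germ_sum A s P) = sewing_sum inj S Xi t s P.
  move=> [sP /eqP Pt]; rewrite linear_sum; apply: eq_big_seq => -[u v] /=.
  move=> /(subintervals_between sP)/=; rewrite Pt => -[su uv vt].
  by rewrite AE//; lra.
exists y; split.
- by move=> P hP; exists (germ_sum A s P); exact: sumE.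
- move=> e e0; have /cvgrPdist_le/(_ _ e0)[d d0 hd] := y_lim.
  exists d => // P hP Pd; exists (germ_sum A s P - y).
    by rewrite linearB sumE.
  by rewrite lee_fin distrC; exact: hd.
- exists (y - A s t); first by rewrite linearB AE// subrr semi.1.
  rewrite lee_fin; apply: le_trans y_le _.
  set L := \sum_(i : J) (1 - (be + rho i))^-1.
  have inv_ge0 i : 0 <= (1 - (be + rho i))^-1 by rewrite invr_ge0 subr_ge0 ltW.
  have inv_le i : (1 - (be + rho i))^-1 <= L.
    by rewrite /L (bigD1 i)//= lerDl sumr_ge0.
  have -> : sewing_error_cst = sewing_cst mu * (C * L).
    by rewrite /sewing_error_cst -mulrA.
  rewrite -(mulrA (sewing_cst mu)) -(mulrA (sewing_cst mu)).
  apply: ler_wpM2l; first exact: sewing_cst_ge0.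
  rewrite mulr_sumr; apply: ler_sum => i _.
  rewrite (_ : mu - (be + rho i) = mu - rho i - be); last by ring.
  set q := _ `^ (mu - rho i - be).
  have -> : k i / (1 - (be + rho i)) * q
      = C * N * s `^ (- eta2 i) * q * (1 - (be + rho i))^-1.
    by rewrite /k mulrAC.
  have -> : C * L * N * (s `^ (- eta2 i) * q) = C * N * s `^ (- eta2 i) * q * L.
    by ring.
  by rewrite ler_wpM2l// !mulr_ge0 ?powR_ge0.
Qed.

End Gain.

(** * The limit at time zero *)
Variable I : forall t : R, R -> V al t.
Hypothesis I_tends : forall s t : R, 0 < s -> s < t -> t <= T ->
  sums_tend_to inj S Xi al t s (inj al t (I t s)).

Lemma sewn_in_scale (be t s : R) : 0 <= be -> be <= B ->
    (forall i, be + rho i <= B) -> (forall i, be + rho i < 1) ->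
    0 < s -> s < t -> t <= T ->
  (exists y : V (al + be) t, inj (al + be) t y = inj al t (I t s)) /\
  norm_le inj (al + be) t (inj al t (I t s) - inj al t (Xi t s))
    (sewing_error_cst be * N *
      \sum_(i : J) s `^ (- eta2 i) * (t - s) `^ (mu - rho i - be))%:E.
Proof.
move=> be0 beB beRB beR s0 st tT; have t0 : 0 <= t by lra.
have [y [_ y_tends y_le]] := sewing_in_scale be0 beB beRB beR s0 st tT.
have yI : inj (al + be) t y = inj al t (I t s).
  apply: (sums_tend_to_unique nested s0 st tT _ (I_tends s0 st tT)).
  by apply: (sums_tend_to_embed nested (b := al + be)); rewrite // lerDl.
by rewrite -yI; split=> //; exists y.
Qed.

Variable N1 : R.
Hypothesis N1_ge0 : 0 <= N1.
Hypothesis Xit_le : forall s t, 0 < s -> s < t -> t <= T ->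
  `|Xit t s| <= N1 * (s `^ (- eta1) * (t - s) `^ sigma).
Hypothesis sigma_gt0 : 0 < sigma.
Hypothesis eta1_ge0 : 0 <= eta1.
Hypothesis eta1_sigma : eta1 < sigma.
Hypothesis eta2_mu : forall i, eta2 i + rho i < mu.
Hypothesis B_ge0 : 0 <= B.
Hypothesis rho_B : forall i, rho i <= B.

(** This is the estimate with gain 0. The restriction to [s <= 2 * s'] makes the
    negative powers of [s'] comparable with those of [s], and the assumptions
    [eta1 < sigma], [eta2 i + rho i < mu] make all resulting exponents positive. *)
Lemma sewn_window (s s' : R) : 0 < s' -> s <= 2 * s' -> s' < s -> s <= T ->
  norm_le inj al s (inj al s (I s s'))
    (C * N1 * 2 `^ eta1 * s `^ (sigma - eta1)
     + \sum_(i : J) sewing_error_cst 0 * N * 2 `^ eta2 i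
         * s `^ (mu - rho i - eta2 i))%:E.
Proof.
move=> s'0 s2 s's sT.
have rho0B i : 0 + rho i <= B by rewrite add0r.
have rho01 i : 0 + rho i < 1 by rewrite add0r.
have [_] := sewn_in_scale (lexx 0) B_ge0 rho0B rho01 s'0 s's sT.
rewrite addr0 => errI.
have -> : inj al s (I s s')
    = inj al s (Xi s s') + (inj al s (I s s') - inj al s (Xi s s')).
  by rewrite addrC subrK.
apply: norm_leD.
  rewrite XiE//.
  have h : norm_le inj al s (inj al s (Xit s s'))
      (N1 * (s' `^ (- eta1) * (s - s') `^ sigma))%:E.
    by exists (Xit s s') => //; rewrite lee_fin Xit_le.
  have : norm_le inj al s (S (s - s') (inj al s (Xit s s')))
      (C * (N1 * (s' `^ (- eta1) * (s - s') `^ sigma)))%:E.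
    by apply: (smoothing_bounded smooth) => //; lra.
  apply: norm_le_weaken; rewrite -!mulrA ler_wpM2l// ler_wpM2l//.
  by apply: powR_window => //; exact: ltW.
apply: norm_le_weaken errI; rewrite mulr_sumr; apply: ler_sum => i _.
rewrite subr0 -[leRHS]mulrA ler_wpM2l//.
  by rewrite mulr_ge0// sewing_error_cst_ge0.
apply: powR_window => //.
by have := eta2_mu i; have := eta2_ge0 i; lra.
Qed.

Section AtZero.
Variable be : R.
Hypothesis be_ge0 : 0 <= be.
Hypothesis be_leB : be <= B.
Hypothesis be_rho_leB : forall i, be + rho i <= B.
Hypothesis be_rho : forall i, be + rho i < 1.

(** In each bracket the first term comes from the bound on [I t (t / 2)], the
    second one from the sum over the dyadic windows below [t / 2]. *)
Definition zero_cst : R :=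
  (C * 2 `^ (- (sigma - be - eta1))
    + C * 2 `^ be * (C * 2 `^ eta1) / (1 - 2 `^ (- (sigma - eta1))))
  + \sum_(i : J) (sewing_error_cst be * 2 `^ (- (mu - rho i - be - eta2 i))
    + C * 2 `^ be * (sewing_error_cst 0 * 2 `^ eta2 i)
      / (1 - 2 `^ (- (mu - rho i - eta2 i)))).

(* exponents and coefficients of the bound on a window; the summand [unit] stands
   for the contribution of [Xi], the summand [J] for those of its defect *)
Let p (j : unit + J) : R :=
  match j with inl _ => sigma - eta1 | inr i => mu - rho i - eta2 i end.

Let c (t : R) (j : unit + J) : R := C * 2 `^ be * t `^ (- be) *
  match j with
  | inl _ => C * N1 * 2 `^ eta1
  | inr i => sewing_error_cst 0 * N * 2 `^ eta2 i
  end.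

Let p_gt0 j : 0 < p j.
Proof.
case: j => [_|i] /=; first by rewrite subr_gt0.
by have := eta2_mu i; lra.
Qed.

Let sum_unitJ (f : unit + J -> R) :
  \sum_j f j = f (inl tt) + \sum_(i : J) f (inr i).
Proof. by rewrite big_sumType (big_pred1 tt)// => -[]. Qed.

Let cst0_ge0 : 0 <= sewing_error_cst 0.
Proof. by apply: sewing_error_cst_ge0 => i; rewrite add0r. Qed.

(** Chasles' relation writes the difference as [S (t - s) (I s s')], and
    [t - s >= t / 2] makes the gain of regularity cost only [t `^ (- be)]. *)
Lemma sewn_step (t s s' : R) : 0 < s' -> s <= 2 * s' -> s' < s ->
    s <= t / 2 -> t <= T ->
  norm_le inj (al + be) t (inj al t (I t s') - inj al t (I t s))
    (\sum_j c t j * s `^ p j)%:E.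
Proof.
move=> s'0 s2 s's st tT.
have s0 : 0 < s := lt_trans s'0 s's.
have s_lt_t : s < t by lra.
have sT : s <= T by lra.
have -> : inj al t (I t s') - inj al t (I t s) = S (t - s) (inj al s (I s s')).
  rewrite (sums_tend_to_additive nested semi smooth B_ge0 s'0 s's s_lt_t tT
    (I_tends s'0 (lt_trans s's s_lt_t) tT) (I_tends s0 s_lt_t tT)
    (I_tends s'0 s's sT)).
  by rewrite addrC addKr.
have h : norm_le inj al t (inj al s (I s s'))
    (C * N1 * 2 `^ eta1 * s `^ (sigma - eta1)
     + \sum_(i : J) sewing_error_cst 0 * N * 2 `^ eta2 i
         * s `^ (mu - rho i - eta2 i))%:E.
  apply: (norm_le_embed nested (b := al) (s := s)); try lra.
  exact: sewn_window.
set g := (X in norm_le inj al t _ X%:E) in h.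
have g0 : 0 <= g.
  apply: addr_ge0; first by rewrite !mulr_ge0 ?powR_ge0.
  apply: sumr_ge0 => i _; apply/mulr_ge0/powR_ge0/mulr_ge0/powR_ge0.
  exact: mulr_ge0.
have : norm_le inj (al + be) t (S (t - s) (inj al s (I s s')))
    (C * (t - s) `^ (- be) * g)%:E.
  by apply: smooth => //; lra.
apply: norm_le_weaken.
have -> : \sum_j c t j * s `^ p j = C * (2 `^ be * t `^ (- be)) * g.
  rewrite sum_unitJ /c /p /g mulrDr mulr_sumr; congr (_ + _); first by ring.
  by apply: eq_bigr => i _; ring.
rewrite ler_wpM2r// ler_wpM2l//.
apply: (@le_trans _ _ ((t / 2) `^ (- be))).
  by apply: powR_antitone => //; lra.
by rewrite powR_half ?opprK//; lra.
Qed.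

(** The limit exists by chaining windows below [t / 2]; at [t / 2] itself
    the integral is estimated by [Xi] plus the sewing error. *)
Theorem sewn_limit_at_zero (t : R) : 0 < t -> t <= T ->
  exists (It : R -> V (al + be) t) (It0 : V (al + be) t),
    [/\ forall s, 0 < s -> s < t -> inj (al + be) t (It s) = inj al t (I t s),
        It s @[s --> 0^'+] --> It0 &
        `|It0| <= zero_cst * (N1 * t `^ (sigma - be - eta1)
          + \sum_(i : J) N * t `^ (mu - rho i - be - eta2 i))].
Proof.
move=> t0 tT; have t0' := ltW t0.
have exI s : exists y : V (al + be) t, 0 < s -> s < t ->
    inj (al + be) t y = inj al t (I t s).
  have [/andP[s0 st]|nst] := boolP ((0 < s) && (s < t)); last first.
    by exists 0 => s0 st; rewrite s0 st in nst.
  have [[y yE] _] := sewn_in_scale be_ge0 be_leB be_rho_leB be_rho s0 st tT.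
  by exists y.
have [It ItE] := choice exI.
have r0 : 0 < t / 2 by lra.
have c_ge0 j : 0 <= c t j.
  apply: mulr_ge0; first by rewrite !mulr_ge0 ?powR_ge0.
  case: j => [_|i]; first by rewrite !mulr_ge0 ?powR_ge0.
  by apply/mulr_ge0/powR_ge0/mulr_ge0.
have It_step s s' : 0 < s' -> s <= 2 * s' -> s' < s -> s <= t / 2 ->
    `|It s' - It s| <= \sum_j c t j * s `^ p j.
  move=> s'0 s2 s's st; apply: (norm_le_inj nested t0' tT).
  by rewrite linearB !ItE; [exact: sewn_step|lra..].
have [It0 It_lim It0_le] := dyadic_limit r0 c_ge0 p_gt0 It_step.
exists It, It0; split=> //.
have half_lt : t / 2 < t by lra.
have It_half : `|It (t / 2)| <=
    C * 2 `^ (- (sigma - be - eta1)) * (N1 * t `^ (sigma - be - eta1))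
    + \sum_(i : J) sewing_error_cst be * 2 `^ (- (mu - rho i - be - eta2 i))
        * (N * t `^ (mu - rho i - be - eta2 i)).
  apply: (norm_le_inj nested t0' tT); rewrite ItE//.
  have [_] := sewn_in_scale be_ge0 be_leB be_rho_leB be_rho r0 half_lt tT.
  have -> : t - t / 2 = t / 2 by lra.
  move=> errI; rewrite -[inj al t _](subrK (inj al t (Xi t (t / 2)))).
  rewrite [X in norm_le _ _ _ X]addrC.
  apply: norm_leD.
    rewrite XiE// (_ : t - t / 2 = t / 2); last by lra.
    have h : norm_le inj al t (inj al t (Xit t (t / 2)))
        (N1 * ((t / 2) `^ (- eta1) * (t / 2) `^ sigma))%:E.
      exists (Xit t (t / 2)) => //; rewrite lee_fin.
      by have := Xit_le r0 half_lt tT; rewrite (_ : t - t / 2 = t / 2); last lra.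
    have : norm_le inj (al + be) t (S (t / 2) (inj al t (Xit t (t / 2))))
        (C * (t / 2) `^ (- be)
          * (N1 * ((t / 2) `^ (- eta1) * (t / 2) `^ sigma)))%:E.
      by apply: smooth => //; lra.
    apply: norm_le_weaken; rewrite le_eqVlt; apply/orP; left; apply/eqP.
    have -> : C * (t / 2) `^ (- be) * (N1 * ((t / 2) `^ (- eta1) * (t / 2) `^ sigma))
        = C * N1 * (t / 2) `^ (sigma - be - eta1).
      have nz : t / 2 != 0 by rewrite gt_eqF.
      by rewrite 2?powRD ?nz ?implybT//; ring.
    by rewrite powR_half//; ring.
  apply: norm_le_weaken errI; rewrite mulr_sumr; apply: ler_sum => i _.
  rewrite -powRD; last by rewrite (gt_eqF r0) implybT.
  rewrite (_ : - eta2 i + _ = mu - rho i - be - eta2 i); last by ring.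
  by rewrite powR_half// le_eqVlt; apply/orP; left; apply/eqP; ring.
have total_le : dyadic_total (c t) p (t / 2) <=
    C * 2 `^ be * (C * 2 `^ eta1) / (1 - 2 `^ (- (sigma - eta1)))
      * (N1 * t `^ (sigma - be - eta1))
    + \sum_(i : J) C * 2 `^ be * (sewing_error_cst 0 * 2 `^ eta2 i)
      / (1 - 2 `^ (- (mu - rho i - eta2 i)))
        * (N * t `^ (mu - rho i - be - eta2 i)).
  have nz : t != 0 by rewrite gt_eqF.
  have half_le j : (t / 2) `^ p j <= t `^ p j.
    by apply: ge0_ler_powR; rewrite ?nnegrE ?(ltW (p_gt0 j))//; lra.
  apply: (@le_trans _ _ (\sum_j c t j / (1 - 2 `^ (- p j)) * t `^ p j)).
    apply: ler_sum => j _; rewrite ler_wpM2l// divr_ge0// subr_ge0 ltW//.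
    by rewrite two_powR_lt1// oppr_lt0.
  rewrite sum_unitJ /c /p le_eqVlt; apply/orP; left; apply/eqP; congr (_ + _).
    rewrite (_ : sigma - be - eta1 = (sigma - eta1) + - be); last by ring.
    by rewrite [t `^ (_ + - be)]powRD ?nz ?implybT//; ring.
  apply: eq_bigr => i _.
  rewrite (_ : mu - rho i - be - eta2 i = (mu - rho i - eta2 i) + - be); last by ring.
  by rewrite [t `^ (_ + - be)]powRD ?nz ?implybT//; ring.
have : `|It0| <= dyadic_total (c t) p (t / 2) + `|It (t / 2)|.
  rewrite -[X in `|X|](subrK (It (t / 2))).
  by apply: le_trans (ler_normD _ _) _; rewrite lerD2r.
move=> /le_trans; apply; apply: le_trans (lerD total_le It_half) _.
have inv_ge0 j : 0 <= (1 - 2 `^ (- p j))^-1.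
  by rewrite invr_ge0 subr_ge0 ltW// two_powR_lt1// oppr_lt0.
have Db_ge0 : 0 <= sewing_error_cst be by exact: sewing_error_cst_ge0.
rewrite [leLHS]addrC addrACA -mulrDl -big_split /=.
rewrite /zero_cst (eq_bigr (fun i : J =>
    (sewing_error_cst be * 2 `^ (- (mu - rho i - be - eta2 i))
      + C * 2 `^ be * (sewing_error_cst 0 * 2 `^ eta2 i)
        / (1 - 2 `^ (- (mu - rho i - eta2 i))))
    * (N * t `^ (mu - rho i - be - eta2 i)))); last first.
  by move=> i _; rewrite -mulrDl.
apply: ler_sum_product => [||i|i].
- rewrite addr_ge0 ?mulr_ge0 ?powR_ge0//.
  exact: (inv_ge0 (inl tt)).
- by rewrite mulr_ge0 ?powR_ge0.
- have h1 := mulr_ge0 Db_ge0 (powR_ge0 2 (- (mu - rho i - be - eta2 i))).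
  have h2 := mulr_ge0 cst0_ge0 (powR_ge0 2 (eta2 i)).
  have h3 := mulr_ge0 C_ge0 (powR_ge0 2 be).
  exact: addr_ge0 h1 (mulr_ge0 (mulr_ge0 h3 h2) (inv_ge0 (inr i))).
- by rewrite mulr_ge0 ?powR_ge0.
Qed.

End AtZero.
End GermLimits.
Theorem lemma3p1 (R : realType) (T : R) (T_gt0 : 0 < T)
    (E : lmodType R) (V : R -> R -> completeNormedModType R)
    (inj : forall a t : R, {linear V a t -> E})
    (S : R -> {linear E -> E})
    (V_nested : nested_scale T inj)
    (S_semigroup : semigroup S)
    (S_smoothing : smoothing T inj S)
    (S_regular : time_regularity T inj S)
    (J : finType) (sigma mu eta1 : R) (eta2 rho : J -> R) (alpha beta : R)
    (sigma_gt0 : 0 < sigma) (sigma_le1 : sigma <= 1) (mu_gt1 : 1 < mu)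
    (eta1_ge0 : 0 <= eta1) (eta2_ge0 : forall i : J, 0 <= eta2 i)
    (rho_ge0 : forall i : J, 0 <= rho i) (rho_lt1 : forall i : J, rho i < 1)
    (beta_ge0 : 0 <= beta) (beta_rho : forall i : J, beta + rho i < 1) :
  (exists C : R,
    forall (Xi Xit : forall t : R, R -> V alpha t)
      (Xid : forall (i : J) (t : R), R -> R -> V (alpha - rho i) t),
    in_C2 T inj S sigma mu eta1 eta2 Xi Xit Xid ->
    exists I : forall t : R, R -> V alpha t,
    [/\ forall s t : R, 0 < s -> s < t -> t <= T ->
          sewing_limit inj S Xi s (I t s),
        forall s u t : R, 0 < s -> s < u -> u < t -> t <= T ->
          inj alpha t (I t s)
          = inj alpha t (I t u) + S (t - u) (inj alpha u (I u s)) &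
        forall s t : R, 0 < s -> s < t -> t <= T ->
          norm_le inj (alpha + beta) t
            (inj alpha t (I t s) - inj alpha t (Xi t s))
            (C%:E * seminorm3 T mu eta2 Xid *
              (\sum_(i : J) s `^ (- eta2 i)
                 * `|t - s| `^ (mu - rho i - beta))%:E)%E]) /\
  (eta1 < sigma -> (forall i : J, eta2 i + rho i < mu) ->
   exists C : R,
    forall (Xi Xit : forall t : R, R -> V alpha t)
      (Xid : forall (i : J) (t : R), R -> R -> V (alpha - rho i) t),
    in_C2 T inj S sigma mu eta1 eta2 Xi Xit Xid ->
    forall I : forall t : R, R -> V alpha t,
    (forall s t : R, 0 < s -> s < t -> t <= T ->
       sewing_limit inj S Xi s (I t s)) ->
    forall t : R, 0 < t -> t <= T ->
    exists (It : R -> V (alpha + beta) t) (It0 : V (alpha + beta) t),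
    [/\ forall s : R, 0 < s -> s < t ->
          inj (alpha + beta) t (It s) = inj alpha t (I t s),
        It s @[s --> 0^'+] --> It0 &
        ((`|It0|)%:E <=
          C%:E * (seminorm2 T sigma eta1 Xit
                    * (t `^ (sigma - beta - eta1))%:E
                  + \sum_(i : J) seminorm3 T mu eta2 Xid
                      * (t `^ (mu - rho i - beta - eta2 i))%:E))%E]).
Proof.
set B := beta + 1.
have [C C_ge0 smooth] := smoothing_uniform S_smoothing alpha B.
have beta_B : beta <= B by rewrite lerDl.
have B_ge0 : 0 <= B by exact: le_trans beta_B.
have beta_rho_B i : beta + rho i <= B by rewrite lerD2l ltW.
have rho_B i : rho i <= B by apply: le_trans (beta_rho_B i); rewrite lerDr.
split.
  exists (sewing_error_cst mu rho C beta) => Xi Xit Xid [XiE deltaE _ fin3].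
  have [N [N_ge0 NE Xid_le]] := seminorm3_bound T_gt0 fin3.
  have exI t s : exists x : V alpha t, 0 < s -> s < t -> t <= T ->
      [/\ sewing_limit inj S Xi s x,
          sums_tend_to inj S Xi alpha t s (inj alpha t x) &
          norm_le inj (alpha + beta) t (inj alpha t x - inj alpha t (Xi t s))
            (sewing_error_cst mu rho C beta * N *
              \sum_(i : J) s `^ (- eta2 i) * (t - s) `^ (mu - rho i - beta))%:E].
    have [/and3P[s0 st tT]|no] := boolP [&& 0 < s, s < t & t <= T]; last first.
      by exists 0 => s0 st tT; rewrite s0 st tT in no.
    have t0 : 0 <= t by lra.
    have a_le : alpha <= alpha + beta by rewrite lerDl.
    have [y [sums_in y_lim y_le]] := sewing_in_scale V_nested S_semigroup mu_gt1
      eta2_ge0 rho_ge0 rho_lt1 C_ge0 smooth XiE deltaE N_ge0 Xid_le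
      beta_ge0 beta_B beta_rho_B beta_rho s0 st tT.
    have embed (z : V (alpha + beta) t) :
        exists x : V alpha t, inj alpha t x = inj (alpha + beta) t z.
      have [x xE _] := V_nested.2 _ _ _ _ t0 (lexx t) tT a_le z.
      by exists x.
    have [x xy] := embed y.
    have x_lim : sums_tend_to inj S Xi alpha t s (inj alpha t x).
      by rewrite xy; exact: (sums_tend_to_embed V_nested t0 tT a_le).
    exists x => _ _ _; split=> //; last by rewrite xy.
    apply: (tends_sewing_limit V_nested t0 tT) => // P /sums_in[z <-].
    exact: embed.
  pose I t s := sval (cid (exI t s)).
  have IP t s := svalP (cid (exI t s)); rewrite -/(I _ _) in IP.
  exists I; split=> [s t s0 st tT|s u t s0 su ut tT|s t s0 st tT].
  - by have [] := IP t s s0 st tT.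
  - have st := lt_trans su ut; have uT := le_trans (ltW ut) tT.
    have [_ hts _] := IP t s s0 st tT.
    have [_ htu _] := IP t u (lt_trans s0 su) ut tT.
    have [_ hus _] := IP u s s0 su uT.
    exact: (sums_tend_to_additive V_nested S_semigroup smooth B_ge0 s0 su ut tT
      hts htu hus).
  - have [_ _] := IP t s s0 st tT.
    by rewrite NE -!EFinM gtr0_norm ?subr_gt0.
move=> eta1_sigma eta2_mu.
exists (zero_cst mu sigma eta1 eta2 rho C beta).
move=> Xi Xit Xid [XiE deltaE fin2 fin3] I I_lim t t0 tT.
have [N [N_ge0 NE Xid_le]] := seminorm3_bound T_gt0 fin3.
have [N1 [N1_ge0 N1E Xit_le]] := seminorm2_bound T_gt0 fin2.
have I_tends s' t' : 0 < s' -> s' < t' -> t' <= T ->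
    sums_tend_to inj S Xi alpha t' s' (inj alpha t' (I t' s')).
  by move=> s'0 s't' t'T; apply: sewing_limit_tends; exact: I_lim.
have [It [It0 [ItE It_lim It0_le]]] := sewn_limit_at_zero V_nested S_semigroup
  mu_gt1 eta2_ge0 rho_ge0 rho_lt1 C_ge0 smooth XiE deltaE N_ge0 Xid_le I_tends
  N1_ge0 Xit_le sigma_gt0 eta1_ge0 eta1_sigma eta2_mu B_ge0 rho_B
  beta_ge0 beta_B beta_rho_B beta_rho t0 tT.
exists It, It0; split=> //.
rewrite NE N1E.
under eq_bigr do rewrite -EFinM.
by rewrite -EFinM sumEFin -EFinD -EFinM lee_fin.
Qed.
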